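(* Let $N\ge 2$ be an integer. Let $\sigma=\{\lambda_1<\dots<\lambda_N\}$ and $\hat\sigma=\{\hat\lambda_1<\dots<\hat\lambda_N\}$ be two sets of $N$ real numbers, let $K\in\mathbb{R}$ and $n\in\{0,1,\dots,N-1\}$. Let $\mu_1,\dots,\mu_q$, $\hat N$, $\theta^2$ and $\tilde n$ be defined from these data as in the context. Then the following four conditions I)--IV) together are necessary and sufficient for the existence of two $N\times N$ Jacobi matrices $J$ and $\tilde J$ such that $\tilde J$ is obtained from $J$ by the perturbation at place $n$ with parameters $\theta\in(0,1)$ (the positive square root of the given number $\theta^2$) and $M=(\theta^{-2}-1)K$, and such that $\sigma$ is the spectrum of $J$ and $\hat\sigma$ is the spectrum of $\tilde J$. I) (Interlacing.) Put $\lambda_0=-\infty$, $\lambda_{N+1}=+\infty$ and let $p\in\{0,1,\dots,N\}$ be such that $\lambda_p<K\le\lambda_{p+1}$. Then there is exactly one element of $\hat\sigma$ in each of the following intervals: $[\lambda_j,\lambda_{j+1})$ for $j=1,\dots,p-1$; $(\lambda_j,\lambda_{j+1}]$ for $j=p+1,\dots,N-1$; $[\lambda_p,K)$ if $p\ge 1$; and $(K,\lambda_{p+1}]$ if $p\le N-1$ and this interval is not empty. II) $\theta^2=\hat N(\mu_1)=\hat N(\mu_2)=\dots=\hat N(\mu_q)\in(0,1)$ (for $q=0$ this reads $\theta^2\in(0,1)$). III) If $K\notin\sigma\cup\hat\sigma$, then $q\le\tilde n$ and $\hat N(K)=\theta^2$. IV) If $K\in\sigma\cup\hat\sigma$, then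 $K\in\sigma\cap\hat\sigma$ and either a) $q\le\tilde n$ and $\hat N(K)>\theta^2$, or b) $q<\tilde n$, $\hat N(K)=\theta^2$ and $\hat N'(K)=0$ (where $'$ denotes the derivative).
   Context: An $N\times N$ Jacobi matrix is a real symmetric tridiagonal matrix with diagonal entries $a_0,\dots,a_{N-1}\in\mathbb{R}$ and off-diagonal entries $b_0,\dots,b_{N-2}$ ($b_i$ in positions $(i,i+1)$ and $(i+1,i)$, rows and columns being indexed by $0,\dots,N-1$); throughout, the off-diagonal entries are negative, $b_i<0$. Perturbation at place $n$: for $\theta\in(0,1)$ and $M\in\mathbb{R}$, the matrix $\tilde J$ has the same entries as $J$ except that $$\tilde a_n=\theta^2(a_n+M),\qquad \tilde b_{n-1}=\theta b_{n-1},\qquad \tilde b_n=\theta b_n,$$ where the equality for $\tilde b_{n-1}$ is omitted when $n=0$ and the equality for $\tilde b_n$ is omitted when $n=N-1$. Notation attached to the data $(\sigma,\hat\sigma,K,n)$: - $\{\mu_1,\dots,\mu_q\}:=(\sigma\cap\hat\sigma)\setminus\{K\}$, a set of $q$ elements ($q:=0$ if this set is empty). - $\hat N(\lambda):=\dfrac{\prod_{j=1}^N(\lambda-\hat\lambda_j)}{\prod_{j=1}^N(\lambda-\lambda_j)}$, considered as a rational function after cancellation of common factors (so it is defined at points of $\sigma\cap\hat\sigma$). - If $q\ge 1$, then $\theta^2:=\hat N(\mu_1)$. If $q=0$, then $\theta^2$ is an arbitrarily chosen number in $(0,\hat N(K)]$, fixed once and for all as part of the data (in this case it is understood that $\hat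 N(K)$ is finite and positive, so that such a choice is possible). - $\tilde n:=\min(n,N-n-1)$. *)

(* Defs.v *)
From HB Require Import structures.
From mathcomp Require Import all_boot all_order all_algebra.
From mathcomp Require Import all_classical all_reals all_analysis.

Set Implicit Arguments.
Unset Strict Implicit.
Unset Printing Implicit Defensive.

Import Order.TTheory GRing.Theory Num.Theory.
Import numFieldNormedType.Exports.

Local Open Scope ring_scope.

Definition adjacent (N : nat) (i j : 'I_N) : bool :=
  (j == i.+1 :> nat) || (i == j.+1 :> nat).

Definition is_jacobi (R : realType) (N : nat) (J : 'M[R]_N) : Prop :=
  [/\ J^T = J,
      forall i j, i != j -> ~~ adjacent i j -> J i j = 0
    & forall i j, adjacent i j -> J i j < 0].

(* The neighbour of n on either side is simply absent from 'I_N when n is the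
   first or the last index. *)
Definition perturb (R : realType) (N : nat) (n : 'I_N) (theta M : R)
    (J : 'M[R]_N) : 'M[R]_N :=
  \matrix_(i, j)
    if (i == n) && (j == n) then theta ^+ 2 * (J n n + M)
    else if adjacent i j && ((i == n) || (j == n)) then theta * J i j
    else J i j.

Definition is_spectrum (R : realType) (N : nat) (s : seq R) (J : 'M[R]_N) :
  Prop := forall x : R, eigenvalue J x = (x \in s).

Definition root_poly (R : realType) (s : seq R) : {poly R} :=
  \prod_(x <- s) ('X - x%:P).

Definition Nhat_num (R : realType) (s hs : seq R) : {poly R} :=
  root_poly hs %/ gcdp (root_poly hs) (root_poly s).

Definition Nhat_den (R : realType) (s hs : seq R) : {poly R} :=
  root_poly s %/ gcdp (root_poly hs) (root_poly s).

(* Meaningful as long as the reduced denominator does not vanish at x; at a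
   pole the value is 0 because x / 0 = 0. *)
Definition Nhat (R : realType) (s hs : seq R) (x : R) : R :=
  (Nhat_num s hs).[x] / (Nhat_den s hs).[x].

Definition is_common (R : realType) (s hs : seq R) (K : R) (mu : seq R) :
  Prop := uniq mu /\ mu =i [pred x | [&& x \in s, x \in hs & x != K]].

Definition is_theta2 (R : realType) (s hs : seq R) (K : R) (mu : seq R)
    (theta2 : R) : Prop :=
  if mu is mu1 :: _ then theta2 = Nhat s hs mu1
  else (Nhat_den s hs).[K] != 0 /\ 0 < theta2 <= Nhat s hs K.

(* lambda_j of an increasing sequence of length N, with 1-based indices
   and lambda_0 = -oo, lambda_(N+1) = +oo. *)
Definition elambda (R : realType) (s : seq R) (j : nat) : \bar R :=
  nth +oo%E (-oo%E :: [seq x%:E | x <- s]) j.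

Definition one_in (R : realType) (hs : seq R) (I : interval (\bar R)) : Prop :=
  exists! x : R, x \in hs /\ x%:E \in I.

Definition interlacing (R : realType) (N : nat) (s hs : seq R) (K : R) : Prop :=
  let l := elambda s in
  exists p : nat, [/\ (p <= N)%N, (l p < K%:E <= l p.+1)%E &
    [/\ forall j, (1 <= j < p)%N -> one_in hs `[l j, l j.+1[,
        forall j, (p < j < N)%N -> one_in hs `]l j, l j.+1],
        (1 <= p)%N -> one_in hs `[l p, K%:E[
      & (p < N)%N -> (K%:E < l p.+1)%E -> one_in hs `]K%:E, l p.+1] ] ].

(* Main.v *)
Require Import Defs.
From HB Require Import structures.
From mathcomp Require Import all_boot all_order all_algebra.
From mathcomp Require Import all_classical all_reals all_analysis.
From mathcomp Require Import ring lra zify.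
From mathcomp Require polyrcf.

(* Let L and R be the characteristic polynomials of the blocks of J before and
   after the index n, and let P and P^ be those of J and J~.  Expanding the
   determinants at n gives
     P = (X - a_n) L R - b_{n-1}^2 L' R - b_n^2 L R',
     P^ = theta^2 P + (1 - theta^2) (X - K) L R,
   L' and R' belonging to the blocks shortened next to n.  So sigma and sigma^
   determine Q = L R, and N^ = theta^2 + (1 - theta^2) (X - K) Q / P.
   Positivity of the Wronskians W(L, L') and W(R, R') shows that
   Q(x) P'(x) >= 0 at every x in sigma, with equality exactly where
   L(x) = R(x) = 0; such an x is a double zero of Q, and there are at most
   min(n, N - n - 1) of them.  Conversely every monic Q of degree N - 1 with
   these properties occurs: the partial fraction expansion of P / Q is split
   between L and R, the residues at common zeros being shared, and each block
   is rebuilt by the Euclidean algorithm.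
   It remains to read the properties of Q off P^ and N^: each lambda <> K in
   sigma owns the half-open interval reaching from it towards K up to the next
   point of sigma or K, and the interlacing condition says that each of these
   intervals contains exactly one point of sigma^. *)

Set Implicit Arguments.
Unset Strict Implicit.
Unset Printing Implicit Defensive.

Import Order.TTheory GRing.Theory Num.Theory.
Import numFieldNormedType.Exports.

Local Open Scope ring_scope.

(** * Polynomials with prescribed simple roots *)

Lemma root_root_poly (R : realType) (s : seq R) x :
  root (root_poly s) x = (x \in s).
Proof. exact: root_prod_XsubC. Qed.

Lemma horner_root_poly0 (R : realType) (s : seq R) x :
  ((root_poly s).[x] == 0) = (x \in s).
Proof. exact: root_root_poly. Qed.

Lemma size_root_poly (R : realType) (s : seq R) :
  size (root_poly s) = (size s).+1.
Proof. exact: size_prod_XsubC. Qed.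

Lemma monic_root_poly (R : realType) (s : seq R) : root_poly s \is monic.
Proof. exact: monic_prod_XsubC. Qed.

Lemma root_poly_cat (R : realType) (s1 s2 : seq R) :
  root_poly (s1 ++ s2) = root_poly s1 * root_poly s2.
Proof. exact: big_cat. Qed.

Lemma perm_root_poly (R : realType) (s1 s2 : seq R) :
  perm_eq s1 s2 -> root_poly s1 = root_poly s2.
Proof. exact: perm_big. Qed.

Lemma horner_root_poly (R : realType) (s : seq R) x :
  (root_poly s).[x] = \prod_(y <- s) (x - y).
Proof. by rewrite horner_prod; apply: eq_bigr => y _; rewrite hornerXsubC. Qed.

Lemma monic_roots (R : realType) (p : {poly R}) (s : seq R) :
  p \is monic -> size p = (size s).+1 -> uniq s -> all (root p) s ->
  p = root_poly s.
Proof.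
move=> mp sp us rs; rewrite {1}(all_roots_prod_XsubC sp rs) ?uniq_rootsE //.
by rewrite (monicP mp) scale1r.
Qed.

Lemma poly_eq_on (R : realType) (p q : {poly R}) (s : seq R) :
  uniq s -> (size p <= size s)%N -> (size q <= size s)%N ->
  {in s, forall x, p.[x] = q.[x]} -> p = q.
Proof.
move=> us sp sq pq; apply/eqP; rewrite -subr_eq0; apply/eqP.
apply: (@roots_geq_poly_eq0 _ _ s); rewrite ?uniq_rootsE //.
  by apply/allP => x xs; rewrite /root !hornerE pq // subrr.
by rewrite (leq_trans (size_polyD _ _)) // size_polyN geq_max sp sq.
Qed.

(** For x in a duplicate-free s this is P / (X - x), the Lagrange basis polynomial before
    normalisation. *)
Definition cofactor_poly (R : realType) (s : seq R) (x : R) : {poly R} :=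
  \prod_(y <- s | y != x) ('X - y%:P).

Lemma root_poly_cofactor (R : realType) (s : seq R) x :
  uniq s -> x \in s -> root_poly s = ('X - x%:P) * cofactor_poly s x.
Proof. by move=> us xs; rewrite /root_poly (bigD1_seq x). Qed.

Lemma horner_cofactor (R : realType) (s : seq R) x z :
  (cofactor_poly s x).[z] = \prod_(y <- s | y != x) (z - y).
Proof. by rewrite horner_prod; apply: eq_bigr => y _; rewrite hornerXsubC. Qed.

Lemma deriv_root_poly (R : realType) (s : seq R) x :
  uniq s -> x \in s -> (root_poly s)^`().[x] = (cofactor_poly s x).[x].
Proof.
move=> us xs; rewrite (root_poly_cofactor us xs) derivM derivXsubC.
by rewrite !hornerE /= subrr; ring.
Qed.

(** The hypothesis covers both z = x and z outside s. *)
Lemma cofactor_neq0 (R : realType) (s : seq R) x z :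
  (z \in s -> z = x) -> (cofactor_poly s x).[z] != 0.
Proof.
move=> h; rewrite horner_cofactor prodf_seq_neq0; apply/allP => y ys.
apply/implyP => yx; rewrite subr_eq0; apply: contra_neqN yx => /eqP zy.
by rewrite -zy; apply: h; rewrite zy.
Qed.

Lemma deriv_root_poly_neq0 (R : realType) (s : seq R) x :
  uniq s -> x \in s -> (root_poly s)^`().[x] != 0.
Proof. by move=> us xs; rewrite deriv_root_poly // cofactor_neq0. Qed.

Lemma size_cofactor (R : realType) (s : seq R) x :
  uniq s -> x \in s -> size (cofactor_poly s x) = size s.
Proof.
move=> us xs; rewrite /cofactor_poly -big_filter size_prod_XsubC.
rewrite (perm_size (perm_to_rem xs)) /= -rem_filter //.
Qed.

Lemma monic_cofactor (R : realType) (s : seq R) x :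
  cofactor_poly s x \is monic.
Proof. exact: monic_prod_XsubC. Qed.

Lemma root_cofactor (R : realType) (s : seq R) x z :
  z \in s -> z != x -> (cofactor_poly s x).[z] = 0.
Proof.
move=> zs zx; apply/eqP; rewrite horner_cofactor prodf_seq_eq0.
by apply/hasP; exists z; rewrite // zx subrr eqxx.
Qed.

Definition interpolation (R : realType) (s : seq R) (f : R -> R) : {poly R} :=
  \sum_(x <- s) (f x / (cofactor_poly s x).[x]) *: cofactor_poly s x.

Lemma horner_interpolation (R : realType) (s : seq R) (f : R -> R) :
  uniq s -> {in s, forall x, (interpolation s f).[x] = f x}.
Proof.
move=> us x xs; rewrite /interpolation horner_sum (bigD1_seq x) //=.
rewrite big_seq_cond big1 => [|y /andP[ys yx]]; last first.
  by rewrite hornerZ (root_cofactor xs) ?mulr0 1?eq_sym.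
by rewrite hornerZ divfK ?addr0 ?cofactor_neq0.
Qed.

Lemma size_interpolation (R : realType) (s : seq R) (f : R -> R) :
  uniq s -> (size (interpolation s f) <= size s)%N.
Proof.
move=> us; rewrite /interpolation; apply: (leq_trans (size_sum _ _ _)).
apply/bigmax_leqP_seq => x xs _.
by rewrite (leq_trans (size_scale_leq _ _)) // size_cofactor.
Qed.

Lemma interpolationE (R : realType) (s : seq R) (q : {poly R}) :
  uniq s -> (size q <= size s)%N -> q = interpolation s (horner q).
Proof.
move=> us sq; apply: (poly_eq_on us) => // [|x xs].
  exact: size_interpolation.
by rewrite horner_interpolation.
Qed.

(** * Strictly interlacing polynomials *)

Lemma prodr_gt0_seq (R : realType) (s : seq R) (P : pred R) (F : R -> R) :
  (forall x, x \in s -> P x -> 0 < F x) -> 0 < \prod_(x <- s | P x) F x.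
Proof.
move=> h; rewrite big_seq_cond; apply: prodr_gt0 => x /andP[]; exact: h.
Qed.

Lemma cofactor_same_sign (R : realType) (s : seq R) x z :
  (forall y, y \in s -> y != x -> 0 < (x - y) * (z - y)) ->
  0 < (cofactor_poly s x).[x] * (cofactor_poly s x).[z].
Proof.
by move=> h; rewrite !horner_cofactor -big_split /=; apply: prodr_gt0_seq.
Qed.

(** Both derivatives are products over the other roots. The factors x - z and z - x multiply to a
    negative number; the remaining ones pair up positively, since no other root separates x from
    z. *)
Lemma deriv_adjacent_roots (R : realType) (s : seq R) x z :
  uniq s -> x \in s -> z \in s -> x != z ->
  (forall y, y \in s -> y != x -> y != z -> 0 < (x - y) * (z - y)) ->
  (root_poly s)^`().[x] * (root_poly s)^`().[z] < 0.
Proof.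
move=> us xs zs xz h; rewrite !deriv_root_poly // !horner_cofactor.
have split2 (u v : R) : v \in s -> v != u ->
    \prod_(y <- s | y != u) (u - y) =
      (u - v) * \prod_(y <- s | (y != u) && (y != v)) (u - y).
  move=> vs vu; rewrite -big_filter (bigD1_seq v) ?filter_uniq //=.
    by rewrite big_filter_cond.
  by rewrite mem_filter vu.
rewrite (split2 x z) 1?eq_sym // (split2 z x) //.
under [X in _ * (_ * X)]eq_bigl do rewrite andbC.
rewrite mulrACA -big_split /= pmulr_llt0; first by nra.
by apply: prodr_gt0_seq => y ys /andP[]; apply: h.
Qed.

(** Sign form of strict interlacing: all residues of q / P are positive. The zeros of q are not
    mentioned, so the condition can be checked point by point on s. *)
Definition strictly_interlaced (R : realType) (s : seq R) (q : {poly R}) :=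
  (size q <= size s)%N /\
  {in s, forall x, 0 < q.[x] * (root_poly s)^`().[x]}.

Lemma strictly_interlaced_weight (R : realType) (s : seq R) (q : {poly R}) x :
  uniq s -> strictly_interlaced s q -> x \in s ->
  0 < q.[x] / (cofactor_poly s x).[x].
Proof.
move=> us [_ h] xs; move: (h _ xs); rewrite deriv_root_poly //.
have h0 : (cofactor_poly s x).[x] != 0 by rewrite cofactor_neq0.
have -> : q.[x] / (cofactor_poly s x).[x] =
    q.[x] * (cofactor_poly s x).[x] / (cofactor_poly s x).[x] ^+ 2 by field.
by move=> hx; rewrite divr_gt0 // exprn_even_gt0.
Qed.

(** By Lagrange interpolation this coefficient is the sum of the residues of q / P, the cofactors
    being monic. *)
Lemma strictly_interlaced_coef (R : realType) (s : seq R) (q : {poly R}) :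
  uniq s -> s != [::] -> strictly_interlaced s q -> 0 < q`_(size s).-1.
Proof.
move=> us s0 hq; rewrite [q](interpolationE us (proj1 hq)) coef_sum.
case: s us s0 hq => // x s us _ hq.
have pos y : y \in x :: s ->
  0 < (q.[y] / (cofactor_poly (x :: s) y).[y] *:
        cofactor_poly (x :: s) y)`_(size (x :: s)).-1.
  move=> ys; rewrite coefZ -(size_cofactor us ys).
  rewrite -/(lead_coef _) (monicP (monic_cofactor _ _)) mulr1.
  exact: strictly_interlaced_weight.
rewrite big_cons ltr_pwDl ?pos ?mem_head // big_seq; apply: sumr_ge0 => y ys.
by rewrite ltW // pos // inE ys orbT.
Qed.

(* With q = sum_x w_x P / (X - x) the Wronskian is sum_x w_x (P / (X - x))^2. *)
Lemma strictly_interlaced_wronskian (R : realType) (s : seq R) (q : {poly R}) z :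
  uniq s -> s != [::] -> strictly_interlaced s q ->
  0 < (root_poly s)^`().[z] * q.[z] - (root_poly s).[z] * q^`().[z].
Proof.
move=> us s0 hq.
pose w x := q.[x] / (cofactor_poly s x).[x].
have -> : (root_poly s)^`().[z] * q.[z] - (root_poly s).[z] * q^`().[z] =
    \sum_(x <- s) w x * (cofactor_poly s x).[z] ^+ 2.
  rewrite {1 2}[q](interpolationE us (proj1 hq)) /interpolation.
  rewrite raddf_sum /= !horner_sum !mulr_sumr -sumrB.
  apply: eq_big_seq => x xs; rewrite /w derivZ !hornerZ.
  by rewrite (root_poly_cofactor us xs) derivM derivXsubC !hornerE /=; ring.
have ge0 x : x \in s -> 0 <= w x * (cofactor_poly s x).[z] ^+ 2.
  move=> xs; rewrite mulr_ge0 ?sqr_ge0 // ltW //.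
  exact: strictly_interlaced_weight.
(* One square has to be nonzero: take x = z if z is a zero of P, and any x in s otherwise. *)
have [x xs zx] : exists2 x, x \in s & (z \in s -> z = x).
  have [zs|_] := boolP (z \in s); first by exists z.
  by case: s s0 {us hq w ge0} => // x s _; exists x; rewrite ?mem_head.
rewrite (bigD1_seq x) //= ltr_pwDl //; last first.
  by rewrite big_seq_cond; apply: sumr_ge0 => y /andP[/ge0].
rewrite mulr_gt0 ?strictly_interlaced_weight // exprn_even_gt0 //=.
exact: cofactor_neq0.
Qed.

Lemma sorted_nth_between (R : realType) (s : seq R) i x :
  sorted <%R s -> (i.+1 < size s)%N -> x \in s ->
  nth 0 s i < x -> nth 0 s i.+1 <= x.
Proof.
move=> ss si /(nthP 0)[j js <-].
rewrite (lt_sorted_ltn_nth 0 ss) ?inE ?(ltnW si) // => ij.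
by rewrite (lt_sorted_leq_nth 0 ss).
Qed.

(** Neighbouring zeros of P give q opposite signs, so each gap holds a zero of q, and the degree
    leaves room for no others. At such a zero the positive Wronskian reduces to - P q', which fixes
    the sign of P. *)
Lemma strictly_interlaced_roots (R : realType) (s : seq R) (q : {poly R}) :
  sorted <%R s -> s != [::] -> strictly_interlaced s q ->
  exists r : seq R, [/\ sorted <%R r, (size r).+1 = size s,
    0 < lead_coef q, q = lead_coef q *: root_poly r
    & {in r, forall y, (root_poly s).[y] * (root_poly r)^`().[y] < 0}].
Proof.
move=> ss s0 hq; have us := lt_sorted_uniq ss.
have [sq hqx] := hq.
have /(_ us s0 hq) qc := @strictly_interlaced_coef R s q.
have sz : size q = size s.
  apply/anti_leq; rewrite sq /= leqNgt; apply/negP => lt.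
  move: qc; rewrite nth_default ?ltxx //.
  by case: (size s) lt.
have lc : 0 < lead_coef q by rewrite /lead_coef sz.
have [m sm] : exists m, size s = m.+1 by case: (s) s0 => // x t; exists (size t).
have /choice[z hz] : forall i, exists z, (i < m)%N ->
    [/\ nth 0 s i < z, z < nth 0 s i.+1 & root q z].
  move=> i; have [im|] := ltnP i m; last by exists 0.
  have [i0 i1] : (i < size s)%N /\ (i.+1 < size s)%N by rewrite sm; split; lia.
  have lt : nth 0 s i < nth 0 s i.+1 by rewrite (lt_sorted_ltn_nth 0 ss).
  have /(polyrcf.poly_ivtoo (ltW lt))[z] : q.[nth 0 s i] * q.[nth 0 s i.+1] < 0.
    have h1 := hqx _ (mem_nth 0 i0); have h2 := hqx _ (mem_nth 0 i1).
    have h3 := @deriv_adjacent_roots R s _ _ us (mem_nth 0 i0) (mem_nth 0 i1).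
    rewrite lt_eqF // in h3.
    have := mulr_gt0 h1 h2; rewrite mulrACA nmulr_lgt0 //.
    apply: h3 => // y ys yi yj.
    have [yl|yl|ye] := ltgtP y (nth 0 s i); [nra| |by rewrite ye eqxx in yi].
    have := sorted_nth_between ss i1 ys yl.
    by rewrite le_eqVlt eq_sym (negbTE yj) /=; nra.
  by rewrite in_itv /= => /andP[z1 z2] rz; exists z.
pose r := mkseq z m.
have sr : sorted <%R r.
  apply/(sortedP 0) => i; rewrite size_mkseq => im.
  rewrite !nth_mkseq ?(ltnW im) //.
  by have [_ h _] := hz i (ltnW im); have [h' _ _] := hz _ im; apply: lt_trans h h'.
have rr : all (root q) r.
  by apply/(all_nthP 0) => i; rewrite size_mkseq => im; rewrite nth_mkseq //; case: (hz i im).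
have qE : q = lead_coef q *: root_poly r.
  apply: all_roots_prod_XsubC => //; first by rewrite size_mkseq sz.
  by rewrite uniq_rootsE lt_sorted_uniq.
exists r; split=> //; first by rewrite size_mkseq sm.
move=> y yr; have := strictly_interlaced_wronskian y us s0 hq.
have qy : q.[y] = 0 by apply/eqP; move/allP: rr; apply.
rewrite qy mulr0 sub0r {1}qE derivZ hornerZ.
by rewrite mulrCA oppr_gt0 pmulr_rlt0.
Qed.

(** * The inverse problem for a pair of polynomials *)

(** The leading terms cancel because both polynomials are monic, and a cancels the next coefficient.
    The remainder is negated so that the recursion produces positive couplings. *)
Lemma divide_monic_step (R : realType) (p q : {poly R}) m :
  p \is monic -> size p = m.+2 -> q \is monic -> size q = m.+1 ->
  exists a, (size (('X - a%:P) * q - p)%R <= m)%N.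
Proof.
move=> mp sp mq sq; pose d : {poly R} := 'X * q - p; exists d`_m; rewrite /d.
have pm : p`_m.+1 = 1 by rewrite -(monicP mp) /lead_coef sp.
have qm : q`_m = 1 by rewrite -(monicP mq) /lead_coef sq.
apply/leq_sizeP => j; rewrite leq_eqVlt => /orP[/eqP <-|].
  by rewrite mulrBl !coefB coefCM qm; ring.
rewrite leq_eqVlt => /orP[/eqP <-|mj].
  rewrite mulrBl !coefB coefCM coefXM /= qm pm [q`_m.+1]nth_default ?sq //.
  by ring.
rewrite mulrBl !coefB coefCM coefXM [q`_j]nth_default ?sq ?(ltnW mj) //.
rewrite [p`_j]nth_default ?sp // gtn_eqF ?(leq_trans _ mj) //.
by rewrite nth_default ?sq; [ring | lia].
Qed.

(** Tridiagonal determinants of the whole list and of its tail. In a pair (a, b), a is a diagonal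
    entry and b is the product of the two off-diagonal entries linking it to the next one. *)
Fixpoint continuants (A : comPzRingType) (s : seq (A * A)) : A * A :=
  if s is (a, b) :: s' then
    let c := continuants s' in (a * c.1 - b * c.2, c.1)
  else (1, 0).

Definition jacobi_polys (R : realType) (s : seq (R * R)) :=
  continuants [seq ('X - e.1%:P, e.2%:P) | e <- s].

Lemma jacobi_polys_size (R : realType) (s : seq (R * R)) :
  [/\ (jacobi_polys s).1 \is monic, size (jacobi_polys s).1 = (size s).+1
    & (size (jacobi_polys s).2 <= size s)%N].
Proof.
elim: s => [|[a b] s [m1 s1 s2]].
  by rewrite /jacobi_polys /= size_poly1 size_poly0 monic1.
rewrite /jacobi_polys /= -/(jacobi_polys s).
have sX : size (('X - a%:P) * (jacobi_polys s).1) = (size s).+2.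
  by rewrite size_monicM ?monicXsubC ?size_XsubC ?s1 // -size_poly_eq0 s1.
have lt : (size (- (b%:P * (jacobi_polys s).2))%R
            < size (('X - a%:P) * (jacobi_polys s).1)%R)%N.
  rewrite size_polyN sX mul_polyC (leq_ltn_trans (size_scale_leq _ _)) //.
  by rewrite ltnS (leq_trans s2).
split; last by rewrite s1.
  by rewrite monicE lead_coefDl // -monicE monicMl ?monicXsubC.
by rewrite size_polyDl // sX.
Qed.

(** One step of the recurrence turns the Wronskian W into p^2 + b W, where p belongs to the tail; a
    single entry gives 1. *)
Lemma jacobi_polys_wronskian (R : realType) (s : seq (R * R)) x :
  (forall e, e \in s -> 0 < e.2) -> s != [::] ->
  let: (p, q) := jacobi_polys s in 0 < p^`().[x] * q.[x] - p.[x] * q^`().[x].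
Proof.
elim: s => // -[a b] s IH pos _.
rewrite /jacobi_polys /= -/(jacobi_polys s).
have step (p q : {poly R}) :
    (('X - a%:P) * p - b%:P * q)^`().[x] * p.[x] -
      (('X - a%:P) * p - b%:P * q).[x] * p^`().[x] =
    p.[x] ^+ 2 + b * (p^`().[x] * q.[x] - p.[x] * q^`().[x]).
  by rewrite derivB !derivM derivXsubC derivC !hornerE /=; ring.
rewrite step; case: s IH pos => [_ _|e s IH pos].
  by rewrite /jacobi_polys /= raddf0 !hornerE; lra.
have /(_ isT) : (e :: s) != [::] -> _ :=
  IH (fun f fs => pos f (mem_behead (s := _ :: _) fs)).
have b0 : 0 < b by apply: (pos (a, b)); rewrite mem_head.
case: (jacobi_polys _) => p q /= w.
by rewrite ltr_wpDl ?sqr_ge0 // mulr_gt0.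
Qed.

(** Euclidean algorithm: dividing P by the monic multiple v of u leaves a negated remainder with
    values - P at the zeros of v. It is therefore strictly interlaced with them, and the recursion
    continues with v and this remainder. *)
Lemma jacobi_polys_inverse (R : realType) (s : seq R) (u : {poly R}) :
  sorted <%R s -> strictly_interlaced s u ->
  exists (c : seq (R * R)) (b : R) (v : {poly R}),
    [/\ size c = size s, forall e, e \in c -> 0 < e.2, 0 < b,
        u = b *: v & jacobi_polys c = (root_poly s, v)].
Proof.
elim: {s}(size s) {-2}s (erefl (size s)) u => [|m IH] s sm u ss hu.
  exists [::], 1, 0; rewrite (size0nil sm) in hu *; split => //.
    by case: hu => /size_poly_leq0P-> _; rewrite scaler0.
  by rewrite /jacobi_polys /= /root_poly big_nil.
have s0 : s != [::] by rewrite -size_eq0 sm.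
have [r [sr szr b0 uE hr]] := strictly_interlaced_roots ss s0 hu.
have {}szr : size r = m by rewrite sm in szr; case: szr.
have [||||a sa] := @divide_monic_step R (root_poly s) (root_poly r) m;
  rewrite ?monic_root_poly ?size_root_poly ?sm ?szr //.
set w := _ - _ in sa.
have [|c [b [v [sc pos bp wE cE]]]] := IH r szr w sr.
  split; first by rewrite szr.
  move=> y yr; have := hr _ yr.
  have ry : (root_poly r).[y] = 0 by apply/eqP; rewrite -/(root _ _) root_root_poly.
  by rewrite /w !hornerE ry; lra.
(* The factor that normalises the remainder becomes the coupling of the first entry; the leading
   coefficient of u is handed on to play the same role one level up. *)
exists ((a, b) :: c), (lead_coef u), (root_poly r); split => //=.
- by rewrite sc szr.
- by move=> e; rewrite inE => /orP[/eqP -> //|/pos].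
- rewrite /jacobi_polys /= -/(jacobi_polys c) cE /= mul_polyC -wE /w.
  by congr (_, _); ring.
Qed.

Lemma jacobi_polys_inverse_uniq (R : realType) (s : seq R) (u : {poly R}) :
  uniq s -> strictly_interlaced s u ->
  exists (c : seq (R * R)) (b : R) (v : {poly R}),
    [/\ size c = size s, forall e, e \in c -> 0 < e.2, 0 < b,
        u = b *: v & jacobi_polys c = (root_poly s, v)].
Proof.
move=> us [su hu]; have sE : root_poly (sort <=%R s) = root_poly s.
  by apply: perm_root_poly; rewrite perm_sort.
have ss : sorted <%R (sort <=%R s) by rewrite sort_lt_sorted.
have [|c [b [v h]]] := jacobi_polys_inverse (u := u) ss.
  by split=> [|x]; rewrite ?size_sort // mem_sort sE; apply: hu.
by exists c, b, v; move: h; rewrite size_sort sE.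
Qed.

(** * Splitting a partial fraction expansion between two blocks *)

Lemma sgn_mulr_div (R : realType) (a b c k : R) :
  b != 0 -> 0 < k -> 0 < a * (b * c) -> 0 < k * (a / b) * c.
Proof.
move=> b0 k0 h; have -> : k * (a / b) * c = k * (a * (b * c)) / b ^+ 2 by field.
by rewrite divr_gt0 ?exprn_even_gt0 // mulr_gt0.
Qed.

(* The common points [z] of the two blocks share the residue at [z] evenly. *)
Lemma partial_fraction_split (R : realType) (z l1 l2 : seq R) (w : {poly R}) :
  uniq (l1 ++ l2 ++ z) ->
  strictly_interlaced (l1 ++ l2 ++ z) w ->
  exists u v : {poly R},
    [/\ strictly_interlaced (l1 ++ z) u, strictly_interlaced (l2 ++ z) v
      & w = u * root_poly l2 + v * root_poly l1].
Proof.
move=> us [sw hw].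
pose half x : R := if x \in z then 2^-1 else 1.
have half0 x : 0 < half x by rewrite /half; case: ifP => _; lra.
(* At a point of l1 or l2 only one term of the decomposition survives, which forces the value of u
   or v there; [half] settles the common points. *)
pose u := interpolation (l1 ++ z) (fun x => half x * (w.[x] / (root_poly l2).[x])).
pose v := interpolation (l2 ++ z) (fun x => half x * (w.[x] / (root_poly l1).[x])).
have := us; rewrite !cat_uniq => /and3P[u1 n12 /and3P[u2 n2z uz]].
have n12' x : x \in l1 -> x \notin l2 /\ x \notin z.
  move=> x1; split; apply: contra n12 => xx; apply/hasP;
    by exists x; rewrite // mem_cat xx ?orbT.
have n2z' x : x \in l2 -> x \notin z.
  by move=> x1; apply: contra n2z => xx; apply/hasP; exists x.
have uu1 : uniq (l1 ++ z).
  rewrite cat_uniq u1 uz andbT /=; apply/hasPn => x xz.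
  by apply: contraL xz => /n12'[].
have uu2 : uniq (l2 ++ z) by rewrite cat_uniq u2 n2z uz.
have uE x : x \in l1 ++ z -> u.[x] = half x * (w.[x] / (root_poly l2).[x]).
  exact: horner_interpolation.
have vE x : x \in l2 ++ z -> v.[x] = half x * (w.[x] / (root_poly l1).[x]).
  exact: horner_interpolation.
have ne2 x : x \in l1 ++ z -> (root_poly l2).[x] != 0.
  rewrite horner_root_poly0 mem_cat => /orP[/n12'[]// | xz].
  by apply: contraL xz => /n2z'.
have ne1 x : x \in l2 ++ z -> (root_poly l1).[x] != 0.
  rewrite horner_root_poly0 mem_cat => /orP[xx | xz]; apply/negP => /n12'[].
    by rewrite xx.
  by rewrite xz.
(* At a zero of one block polynomial, the derivative of the whole product is the derivative of that
   block times the other factor. *)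
have E1 : root_poly (l1 ++ l2 ++ z) = root_poly (l1 ++ z) * root_poly l2.
  by rewrite !root_poly_cat; ring.
have E2 : root_poly (l1 ++ l2 ++ z) = root_poly (l2 ++ z) * root_poly l1.
  by rewrite !root_poly_cat; ring.
have szs (s t : seq R) (p : {poly R}) : (size p <= size s)%N ->
    (size (p * root_poly t)%R <= size (s ++ t))%N.
  move=> h; apply: (leq_trans (size_polyMleq _ _)).
  by rewrite size_root_poly size_cat addnS leq_add2r.
exists u, v; split.
- split=> [|x xx]; first exact: size_interpolation.
  rewrite uE //; apply: sgn_mulr_div => //; first exact: ne2.
  have xs : x \in l1 ++ l2 ++ z.
    by move: xx; rewrite !mem_cat => /orP[]->; rewrite ?orbT.
  have := hw x xs; rewrite E1 derivM !hornerE.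
  have /eqP -> : (root_poly (l1 ++ z)).[x] == 0 by rewrite horner_root_poly0.
  by rewrite mul0r addr0 mulrA => h; rewrite /= mulrAC.
- split=> [|x xx]; first exact: size_interpolation.
  rewrite vE //; apply: sgn_mulr_div => //; first exact: ne1.
  have xs : x \in l1 ++ l2 ++ z.
    by move: xx; rewrite !mem_cat => /orP[]->; rewrite ?orbT.
  have := hw x xs; rewrite E2 derivM !hornerE.
  have /eqP -> : (root_poly (l2 ++ z)).[x] == 0 by rewrite horner_root_poly0.
  by rewrite mul0r addr0 mulrA => h; rewrite /= mulrAC.
- apply: (poly_eq_on us) => //.
    rewrite (leq_trans (size_polyD _ _)) // geq_max.
    rewrite (leq_trans (szs _ _ _ (size_interpolation _ uu1))) /=.
      rewrite (leq_trans (szs _ _ _ (size_interpolation _ uu2))) //.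
      by rewrite !size_cat; lia.
    by rewrite !size_cat; lia.
  move=> x xx; rewrite !hornerE; move: xx; rewrite mem_cat (mem_cat x l2) => /or3P[] xx.
  + have /eqP -> : (root_poly l1).[x] == 0 by rewrite horner_root_poly0.
    have x1 : x \in l1 ++ z by rewrite mem_cat xx.
    rewrite uE // /half (negbTE (proj2 (n12' _ xx))).
    by have := ne2 x x1; move=> h; field.
  + have /eqP -> : (root_poly l2).[x] == 0 by rewrite horner_root_poly0.
    have x1 : x \in l2 ++ z by rewrite mem_cat xx.
    rewrite vE // /half (negbTE (n2z' _ xx)).
    by have := ne1 x x1; move=> h; field.
  + have x1 : x \in l1 ++ z by rewrite mem_cat xx orbT.
    have x2 : x \in l2 ++ z by rewrite mem_cat xx orbT.
    rewrite uE // vE // /half xx.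
    by have h1 := ne1 x x2; have h2 := ne2 x x1; field; rewrite h1 h2.
Qed.

(** Counting for the cut: with z common zeros and y1 others, giving n - z of the others to the left
    makes blocks of sizes n and m - n - 1. *)
Lemma split_sizes (m n z s1 ys y1 : nat) :
  (n < m)%N -> (z <= minn n (m - n - 1))%N -> m = (z + s1)%N ->
  ys.+1 = s1 -> (y1 + z)%N = ys ->
  [/\ (n - z <= y1)%N, (n - z + z)%N = n
    & (y1 - (n - z) + z)%N = (m - n - 1)%N].
Proof. by move=> h1; rewrite leq_min => /andP[h2 h3] h4 h5 h6; split; lia. Qed.

(** Abstracts the characteristic polynomial of J with row and column n deleted: weakly interlaced
    with P, its common zeros with P being at least double and few enough to lie in both blocks. *)
Definition central_minor (R : realType) (s : seq R) (n : nat) (q : {poly R}) :=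
  [/\ q \is monic, size q = size s,
      {in s, forall x, 0 <= q.[x] * (root_poly s)^`().[x]},
      {in s, forall x, root q x -> root q^`() x}
    & (count (root q) s <= minn n (size s - n - 1))%N].

(** Let Z collect the common zeros, P = Z S and q = Z Y. Then Y is strictly interlaced with S and
    still vanishes on the zeros of Z. The partial fraction expansion of S / Y is split between the
    two blocks, and multiplication by Z gives back P. *)
Lemma central_minor_split (R : realType) (s : seq R) (n : nat) (q : {poly R}) :
  sorted <%R s -> (n < size s)%N -> central_minor s n q ->
  exists (cl cr : seq (R * R)) (a bl br : R),
    let: (l, l') := jacobi_polys cl in
    let: (r, r') := jacobi_polys cr in
    [/\ size cl = n /\ size cr = (size s - n - 1)%N,
        (forall e, e \in cl ++ cr -> 0 < e.2), 0 < bl /\ 0 < br, q = l * r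
      & root_poly s = ('X - a%:P) * (l * r) - bl *: (l' * r) - br *: (l * r')].
Proof.
move=> ss ns [mq sq hq dq cq]; have us := lt_sorted_uniq ss.
pose z := [seq x <- s | root q x]; pose s1 := [seq x <- s | ~~ root q x].
have uz : uniq z by apply: filter_uniq.
have ss1 : sorted <%R s1 by apply: sorted_filter => //; apply: lt_trans.
have us1 : uniq s1 by apply: filter_uniq.
have sE : root_poly s = root_poly z * root_poly s1.
  by rewrite -root_poly_cat; apply: perm_root_poly; rewrite perm_sym perm_filterC.
have szz : (size z <= minn n (size s - n - 1))%N by rewrite size_filter.
have szs : size s = (size z + size s1)%N.
  by rewrite !size_filter count_predC.
have [q1 qE] : exists q1, q = q1 * root_poly z.
  apply/dvdpP; apply: uniq_roots_dvdp; rewrite ?uniq_rootsE //.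
  by apply/allP => x; rewrite mem_filter => /andP[].
have mq1 : q1 \is monic by rewrite -(monicMl _ (monic_root_poly z)) mulrC -qE.
have sq1 : size q1 = size s1.
  have := sq; rewrite qE size_Mmonic ?monic_root_poly ?monic_neq0 //.
  by rewrite size_root_poly addnS /= szs addnC => /addnI.
(* At a zero of Z the derivative of q is Y Z', so a double zero of q leaves a zero of Y, here
   [q1]. *)
have dz x : x \in z -> q1.[x] = 0.
  move=> xz; have := xz; rewrite mem_filter => /andP[qx xs].
  have := dq _ xs qx; rewrite /root qE derivM !hornerE.
  have /eqP -> : (root_poly z).[x] == 0 by rewrite horner_root_poly0.
  by rewrite mulr0 add0r mulf_eq0 (negbTE (deriv_root_poly_neq0 uz xz)) orbF => /eqP.
(* At a zero of S one has q P' = Z^2 Y S' with Z nonzero, and there the weak sign condition becomes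
   strict. *)
have hs1 : strictly_interlaced s1 q1.
  split=> [|x x1]; first by rewrite sq1.
  have := x1; rewrite mem_filter => /andP[nq xs].
  have := hq x xs; rewrite le_eqVlt => /orP[|].
    rewrite eq_sym mulf_eq0 (negbTE (deriv_root_poly_neq0 us xs)) orbF.
    by rewrite -/(root q x) (negbTE nq).
  have /eqP s1x : (root_poly s1).[x] == 0 by rewrite horner_root_poly0.
  have z2 : 0 < (root_poly z).[x] ^+ 2.
    by rewrite exprn_even_gt0 //= horner_root_poly0 mem_filter (negbTE nq).
  move=> h; rewrite -(pmulr_rgt0 _ z2); apply: (lt_le_trans h).
  rewrite qE sE derivM !hornerE s1x le_eqVlt; apply/orP; left; apply/eqP.
  by rewrite /=; ring.
have s10 : s1 != [::].
  apply: contraTneq ns => s1n; rewrite -leqNgt szs s1n addn0.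
  by rewrite (leq_trans szz) ?geq_minl.
have [ys [sy szy _]] := strictly_interlaced_roots ss1 s10 hs1.
rewrite (monicP mq1) scale1r => q1E hy; have uy := lt_sorted_uniq sy.
have zy : {subset z <= ys} by move=> x /dz; rewrite -horner_root_poly0 -q1E => ->.
pose y1 := [seq y <- ys | y \notin z].
pose l1 := take (n - size z) y1; pose l2 := drop (n - size z) y1.
have py : perm_eq (l1 ++ l2 ++ z) ys.
  rewrite catA cat_take_drop; apply: uniq_perm => //.
    rewrite cat_uniq filter_uniq // uz andbT; apply/hasPn => x xz.
    by rewrite mem_filter xz.
  move=> x; rewrite mem_cat mem_filter.
  by case: (boolP (x \in z)) => [/zy ->|_] /=; rewrite ?orbT ?orbF.
have sy1 : (size y1 + size z)%N = size ys.
  by rewrite -(perm_size py) catA cat_take_drop size_cat.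
(* At a zero y of Y the negated remainder takes the value - S(y), which has the sign of Y'(y). *)
have [a sw] : exists a, (size (('X - a%:P) * root_poly ys - root_poly s1)%R <= size ys)%N.
  by apply: divide_monic_step; rewrite ?monic_root_poly ?size_root_poly ?szy.
have [||u [v [hu hv]]] := @partial_fraction_split R z l1 l2
    (('X - a%:P) * root_poly ys - root_poly s1).
- by rewrite (perm_uniq py).
- split=> [|y]; first by rewrite (perm_size py).
  rewrite (perm_mem py) (perm_root_poly py) => yy; have := hy _ yy.
  have /eqP yy0 : (root_poly ys).[y] == 0 by rewrite horner_root_poly0.
  by rewrite !hornerE yy0; lra.
have uall : uniq (l1 ++ l2 ++ z) by rewrite (perm_uniq py).
have := uall; rewrite uniq_catCA cat_uniq => /and3P[_ _ ul1].
have := uall; rewrite cat_uniq => /and3P[_ _ ul2] wE.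
have [cl [bl [l' [scl pcl bl0 uE clE]]]] := jacobi_polys_inverse_uniq ul1 hu.
have [cr [br [r' [scr pcr br0 vE crE]]]] := jacobi_polys_inverse_uniq ul2 hv.
exists cl, cr, a, bl, br; rewrite clE crE.
have ysE : root_poly ys = root_poly l1 * root_poly l2 * root_poly z.
  by rewrite -(perm_root_poly py) !root_poly_cat mulrA.
split => //.
- have [y1n nz nz'] := split_sizes ns szz szs szy sy1.
  by rewrite scl scr !size_cat size_takel // size_drop.
- by move=> e; rewrite mem_cat => /orP[/pcl|/pcr].
- by rewrite qE q1E ysE !root_poly_cat; ring.
- rewrite sE; have -> : root_poly s1 = ('X - a%:P) * root_poly ys -
      (u * root_poly l2 + v * root_poly l1) by rewrite -wE; ring.
  by rewrite ysE uE vE !root_poly_cat -!mul_polyC; ring.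
Qed.

(** * Characteristic polynomials of Jacobi matrices *)

(** [T] lives on all pairs of naturals, so trailing blocks differ only by the offset s. Expansion
    along the first row and then the first column yields the recurrence. *)
Lemma det_tridiagonal (A : comNzRingType) (T : nat -> nat -> A) s m :
  (forall i j, (i.+1 < j)%N || (j.+1 < i)%N -> T i j = 0) ->
  \det (\matrix_(i < m, j < m) T (s + i)%N (s + j)%N) =
    (continuants [seq (T i i, T i i.+1 * T i.+1 i) | i <- iota s m]).1.
Proof.
move=> T0.
(* The recurrence reaches two sizes back, so two consecutive sizes are proved together, for every
   offset. *)
suff : forall m s,
  \det (\matrix_(i < m, j < m) T (s + i)%N (s + j)%N) =
    (continuants [seq (T i i, T i i.+1 * T i.+1 i) | i <- iota s m]).1 /\
  \det (\matrix_(i < m.+1, j < m.+1) T (s + i)%N (s + j)%N) =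
    (continuants [seq (T i i, T i i.+1 * T i.+1 i) | i <- iota s m.+1]).1.
  by move=> /(_ m s)[].
move=> {s}{}m; elim: m => [|m IH] s.
  by rewrite det_mx00 det_mx11 mxE /= addn0; split => //; ring.
split; first by case: (IH s).
have [D0 D1] : _ /\ _ := conj (proj2 (IH s.+1)) (proj1 (IH s.+2)).
rewrite (expand_det_row _ ord0) 2!big_ord_recl big1 ?addr0; last first.
  by move=> i _; rewrite mxE T0 ?mul0r //= /bump /=; apply/orP; left; lia.
rewrite !mxE /= !addn0 /bump /= addn1 /cofactor /= addn0 expr0 mul1r.
rewrite add0n expr1 mulN1r.
have -> : row' ord0 (col' ord0 (\matrix_(i < m.+2, j < m.+2)
      T (s + i)%N (s + j)%N)) = \matrix_(i < m.+1, j < m.+1) T (s.+1 + i)%N (s.+1 + j)%N.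
  by apply/matrixP => i j; rewrite !mxE /= /bump /= !addnA addn1.
rewrite D0 (expand_det_col _ ord0) big_ord_recl big1 ?addr0; last first.
  move=> i _; rewrite !mxE T0 ?mul0r //= /bump /=; apply/orP; right; lia.
rewrite !mxE /= /cofactor /= addn0 expr0 mul1r.
rewrite [X in \det X](_ : _ = \matrix_(i < m, j < m) T (s.+2 + i)%N (s.+2 + j)%N); last first.
  by apply/matrixP => i j; rewrite !mxE /= /bump /=; congr T; lia.
rewrite D1 /= /bump /= !addn0 addn1.
by ring.
Qed.

(** Moving the cut past n transfers one entry from the forward to the backward list, and both
    expressions expand to the same terms. Backwards, the coupling of i is [b i]; forwards it is
    [b i.+1]. *)
Lemma continuants_split (A : comPzRingType) (a b : nat -> A) n m :
  let bw := continuants (rev [seq (a i, b i) | i <- iota 0 n]) in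
  let fw := continuants [seq (a i, b i.+1) | i <- iota n m] in
  (continuants [seq (a i, b i.+1) | i <- iota 0 (n + m)]).1 =
    bw.1 * fw.1 - b n * bw.2 * fw.2.
Proof.
elim: n m => [|n IH] m.
  by rewrite /= /rev /= mulr0 mul0r subr0 mul1r.
have -> : iota 0 n.+1 = rcons (iota 0 n) n by rewrite -addn1 iotaD cats1.
rewrite addSnnS; cbv zeta; rewrite (IH m.+1) map_rcons rev_rcons /=.
by ring.
Qed.

(** Read from n - 1 down to 0, so that the second polynomial belongs to the block shortened next to
    n. *)
Definition left_polys (R : realType) (a b : nat -> R) n :=
  jacobi_polys (rev [seq (a i, b i) | i <- iota 0 n]).

Definition right_polys (R : realType) (a b : nat -> R) n m :=
  jacobi_polys [seq (a i, b i.+1) | i <- iota n m].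

Lemma jacobi_polys_center (R : realType) (a b : nat -> R) n m :
  let: (l, l') := left_polys a b n in
  let: (r, r') := right_polys a b n.+1 m in
  (jacobi_polys [seq (a i, b i.+1) | i <- iota 0 (n + m.+1)]).1 =
    ('X - (a n)%:P) * (l * r) - b n *: (l' * r) - b n.+1 *: (l * r').
Proof.
have := @continuants_split _ (fun i => 'X - (a i)%:P) (fun i => (b i)%:P) n m.+1.
rewrite /= /left_polys /right_polys /jacobi_polys map_rev -!map_comp /comp /=.
move=> ->; case: (continuants _) => l l'; case: (continuants _) => r r' /=.
by rewrite -!mul_polyC; ring.
Qed.

Definition jacobi_mx (R : realType) (N : nat) (a c : nat -> R) : 'M[R]_N :=
  \matrix_(i, j) if i == j :> nat then a i
    else if j == i.+1 :> nat then c i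
    else if i == j.+1 :> nat then c j else 0.

(** The squared entry between i - 1 and i. No entry precedes index 0, where [b0] stands in. *)
Definition coupling (R : realType) (b0 : R) (c : nat -> R) (i : nat) : R :=
  if i is j.+1 then c j ^+ 2 else b0.

Lemma char_poly_jacobi_mx (R : realType) (N : nat) (b0 : R) (a c : nat -> R) :
  char_poly (jacobi_mx N a c) =
    (jacobi_polys [seq (a i, coupling b0 c i.+1) | i <- iota 0 N]).1.
Proof.
pose T i j : {poly R} := if i == j then 'X - (a i)%:P
    else if j == i.+1 then - (c i)%:P
    else if i == j.+1 then - (c j)%:P else 0.
have := @det_tridiagonal _ T 0 N _; rewrite /char_poly => h.
rewrite [char_poly_mx _](_ : _ = \matrix_(i < N, j < N) T (0 + i)%N (0 + j)%N).
  rewrite h.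
    rewrite /jacobi_polys -map_comp; congr (continuants _).1.
    apply: eq_map => i /=; rewrite /T !eqxx.
    have -> : (i == i.+1) = false by lia.
    have -> : (i.+1 == i) = false by lia.
    have -> : (i == i.+2) = false by lia.
    by rewrite rmorphXn /=; congr (_, _); ring.
  by move=> i j ij; rewrite /T !ifF //; lia.
apply/matrixP => i j; rewrite !mxE /= /T -val_eqE /=.
case: eqVneq => [//|_] /=; rewrite sub0r; case: ifP => // _; case: ifP => // _.
by rewrite oppr0.
Qed.

Lemma is_jacobi_mx (R : realType) (N : nat) (a c : nat -> R) :
  (forall i, c i < 0) -> is_jacobi (jacobi_mx N a c).
Proof.
move=> c0; split.
- apply/matrixP => i j; rewrite !mxE eq_sym.
  case: eqVneq => [-> //|_].
  by case: eqVneq => // e1; case: eqVneq => // e2; lia.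
- move=> i j ij; rewrite /Defs.adjacent negb_or mxE => /andP[e1 e2].
  by rewrite -val_eqE /= in ij; rewrite (negbTE ij) (negbTE e1) (negbTE e2).
- move=> i j; rewrite /Defs.adjacent mxE => /orP[] /eqP e.
    by rewrite ltn_eqF ?e // eqxx.
  by rewrite gtn_eqF ?e // ltn_eqF ?e // eqxx.
Qed.

Lemma is_jacobi_ex (R : realType) (N : nat) (J : 'M[R]_N) : is_jacobi J ->
  exists a c, (forall i, c i < 0) /\ J = jacobi_mx N a c.
Proof.
case: N J => [|N] J [sJ J0 Jn].
  by exists 0, (fun=> -1); split=> [i|]; [rewrite oppr_lt0|apply/matrixP => -[]].
exists (fun i => J (inord i) (inord i)).
(* Beyond the last off-diagonal entry the value -1 keeps [c] negative everywhere. *)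
exists (fun i => if (i < N)%N then J (inord i) (inord i.+1) else -1).
split=> [i|].
  case: ifP => iN; last by rewrite oppr_lt0.
  by apply: Jn; rewrite /Defs.adjacent !inordK ?eqxx // ltnW.
apply/matrixP => i j; rewrite mxE; case: eqVneq => [/val_inj ->|ij].
  by rewrite inord_val.
case: eqVneq => [ji|ji].
  by rewrite -ltnS -ji ltn_ord !inord_val.
case: eqVneq => [e|e].
  by rewrite -ltnS -e ltn_ord !inord_val -{1}sJ mxE.
by apply: J0; rewrite // /Defs.adjacent (negbTE ji).
Qed.

Lemma perturb_jacobi_mx (R : realType) (N : nat) (n : 'I_N) (t M : R)
    (a c : nat -> R) :
  perturb n t M (jacobi_mx N a c) =
    jacobi_mx N (fun i => if i == n :> nat then t ^+ 2 * (a i + M) else a i)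
      (fun i => if (i == n :> nat) || (i.+1 == n) then t * c i else c i).
Proof.
apply/matrixP => i j; rewrite !mxE eqxx -!val_eqE /= /Defs.adjacent.
case: (eqVneq (i : nat) j) => [ij|ij].
  rewrite ij andbb; case: eqVneq => [-> //|_] /=.
  by rewrite !ltn_eqF.
rewrite ifF; last by apply/negbTE/negP => /andP[/eqP e1 /eqP e2]; rewrite e1 e2 eqxx in ij.
case: eqVneq => [e|e1] /=; first by rewrite e.
by case: eqVneq => [e|e2] //=; rewrite e orbC.
Qed.

Lemma coupling_gt0 (R : realType) (b0 : R) (c : nat -> R) i :
  0 < b0 -> (forall j, c j < 0) -> 0 < coupling b0 c i.
Proof. by case: i => [|i] b00 c0 //=; rewrite exprn_even_gt0 //= lt_eqF. Qed.

(** The blocks beside n are unchanged, the couplings at n acquire t^2, and t^2 (a_n + M) = t^2 a_n +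
    (1 - t^2) K. Hence X minus the new entry is t^2 (X - a_n) + (1 - t^2) (X - K). *)
Lemma char_poly_perturb (R : realType) (N : nat) (n : 'I_N) (t K b0 : R)
    (a c : nat -> R) : t != 0 ->
  let: (l, l') := left_polys a (coupling b0 c) n in
  let: (r, r') := right_polys a (coupling b0 c) n.+1 (N - n - 1) in
  char_poly (perturb n t ((t ^- 2 - 1) * K) (jacobi_mx N a c)) =
    t ^+ 2 *: char_poly (jacobi_mx N a c) +
    (1 - t ^+ 2) *: (('X - K%:P) * (l * r)).
Proof.
move=> t0; rewrite perturb_jacobi_mx !(char_poly_jacobi_mx _ b0).
pose a' i := if i == n :> nat then t ^+ 2 * (a i + (t ^- 2 - 1) * K) else a i.
pose c' i := if (i == n :> nat) || (i.+1 == n) then t * c i else c i.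
rewrite -/a' -/c'.
have NE : N = (n + (N - n - 1).+1)%N by have := ltn_ord n; lia.
rewrite [in iota _ N]NE.
have lE : left_polys a' (coupling b0 c') n = left_polys a (coupling b0 c) n.
  rewrite /left_polys; congr (jacobi_polys (rev _)).
  apply/eq_in_map => i; rewrite mem_iota add0n => /= ilt.
  rewrite /a' ltn_eqF //; congr (_, _); case: i ilt => //= i ilt.
  by rewrite /c' !ltn_eqF // ltnW.
have rE m : right_polys a' (coupling b0 c') n.+1 m = right_polys a (coupling b0 c) n.+1 m.
  rewrite /right_polys; congr jacobi_polys.
  apply/eq_in_map => i; rewrite mem_iota => /= /andP[ilt _].
  rewrite /a' /c' gtn_eqF // (_ : i.+1 == n :> nat = false) //; lia.
have := @jacobi_polys_center R a (coupling b0 c) n (N - n - 1).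
have := @jacobi_polys_center R a' (coupling b0 c') n (N - n - 1).
rewrite lE rE.
(* For n = 0 the coupling before n is [b0], which is not rescaled; its term vanishes because l' =
   0. *)
have l'0 : n = 0 :> nat -> (left_polys a (coupling b0 c) n).2 = 0.
  by move=> ->.
case: (left_polys _ _ _) l'0 => l l' /= l'0; case: (right_polys _ _ _ _) => r r' -> ->.
have -> : a' n = t ^+ 2 * (a n + (t ^- 2 - 1) * K) by rewrite /a' eqxx.
have -> : c' n = t * c n by rewrite /c' eqxx.
have cE m : n = m :> nat ->
    coupling b0 c' m *: (l' * r) = t ^+ 2 *: (coupling b0 c m *: (l' * r)).
  case: m => [/l'0 ->|m e]; first by rewrite mul0r !scaler0.
  by rewrite /= /c' e eqxx orbT exprMn scalerA.
rewrite (cE n (erefl _)).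
have tt : t%:P ^+ 2 * (t ^- 2)%:P = 1 :> {poly R}.
  by rewrite -polyC_exp -polyCM mulfV ?polyC1 // expf_neq0.
rewrite -!mul_polyC !(polyCM, polyCB, polyCD, polyC1, polyC_exp).
apply/subr0_eq.
transitivity ((1 - t%:P ^+ 2 * (t ^- 2)%:P) * (K%:P * (l * r))); first by ring.
by rewrite tt subrr mul0r.
Qed.

(** * Passing between Jacobi matrices and central minors *)

Lemma is_spectrum_char_poly (R : realType) (N : nat) (s : seq R) (J : 'M[R]_N) :
  uniq s -> size s = N ->
  is_spectrum s J <-> char_poly J = root_poly s.
Proof.
move=> us sN; split=> [h | h x]; last first.
  by rewrite eigenvalue_root_char h root_root_poly.
apply: monic_roots; rewrite ?char_poly_monic ?size_char_poly ?sN //.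
by apply/allP => x xs; rewrite -eigenvalue_root_char h.
Qed.

(** Admits the empty block, whose Wronskian is 0 but whose polynomial 1 has no zero. *)
Lemma jacobi_polys_wronskian_ge0 (R : realType) (s : seq (R * R)) x :
  (forall e, e \in s -> 0 < e.2) ->
  let: (p, q) := jacobi_polys s in
  [/\ 0 <= p^`().[x] * q.[x] - p.[x] * q^`().[x]
    & p.[x] = 0 -> 0 < p^`().[x] * q.[x] - p.[x] * q^`().[x]].
Proof.
move=> pos; have := @jacobi_polys_wronskian R s x pos.
case: s pos => [_ _|e s pos /(_ isT)].
  rewrite /jacobi_polys /= hornerC -polyC1 !derivC !hornerE; split; first by lra.
  by move=> /eqP; rewrite oner_eq0.
by case: (jacobi_polys _) => p q h; split=> // ; apply: ltW.
Qed.

Lemma count_common_roots (R : realType) (s : seq R) (p q : {poly R}) :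
  uniq s -> p != 0 -> {in s, forall x, root q x -> root p x} ->
  (count (root q) s < size p)%N.
Proof.
move=> us p0 h; rewrite -size_filter; apply: max_poly_roots; rewrite ?filter_uniq //.
by apply/allP => x; rewrite mem_filter => /andP[qx /h]; apply.
Qed.

(* At a zero x of P = (X - a) l r - bl l' r - br l r' the product P'(x) (l r)(x)
   is the Wronskian (l r)^2 + bl r^2 W(l, l') + br l^2 W(r, r'). *)
Lemma central_minor_of_polys (R : realType) (s : seq R) (n : nat)
    (cl cr : seq (R * R)) (a bl br : R) :
  uniq s -> (n < size s)%N -> size cl = n -> size cr = (size s - n - 1)%N ->
  (forall e, e \in cl -> 0 < e.2) -> (forall e, e \in cr -> 0 < e.2) ->
  0 < bl -> 0 < br ->
  let: (l, l') := jacobi_polys cl in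
  let: (r, r') := jacobi_polys cr in
  root_poly s = ('X - a%:P) * (l * r) - bl *: (l' * r) - br *: (l * r') ->
  central_minor s n (l * r).
Proof.
move=> us ns scl scr pcl pcr bl0 br0.
have hl x := @jacobi_polys_wronskian_ge0 R cl x pcl.
have hr x := @jacobi_polys_wronskian_ge0 R cr x pcr.
have [ml sl _] := jacobi_polys_size cl; have [mr sr _] := jacobi_polys_size cr.
case: (jacobi_polys cl) ml sl hl => l l' /= ml sl hl.
case: (jacobi_polys cr) mr sr hr => r r' /= mr sr hr E.
have W x : x \in s -> (l * r).[x] * (root_poly s)^`().[x] =
    (l.[x] * r.[x]) ^+ 2
    + bl * r.[x] ^+ 2 * (l^`().[x] * l'.[x] - l.[x] * l'^`().[x])
    + br * l.[x] ^+ 2 * (r^`().[x] * r'.[x] - r.[x] * r'^`().[x]).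
  (* Subtracting (l r)' P, which vanishes at x, turns the left side into the Wronskian of P and l
     r. *)
  rewrite -root_root_poly => /eqP Px; rewrite -[LHS]subr0.
  rewrite -(mul0r (l * r)^`().[x]) -Px E.
  rewrite !derivB !derivZ !derivM derivXsubC !hornerE /=; ring.
have nl x : 0 <= bl * r.[x] ^+ 2 * (l^`().[x] * l'.[x] - l.[x] * l'^`().[x]).
  by have [h _] := hl x; rewrite mulr_ge0 // mulr_ge0 ?sqr_ge0 // ltW.
have nr x : 0 <= br * l.[x] ^+ 2 * (r^`().[x] * r'.[x] - r.[x] * r'^`().[x]).
  by have [h _] := hr x; rewrite mulr_ge0 // mulr_ge0 ?sqr_ge0 // ltW.
(* All three terms vanish. A zero of l makes W(l, l') positive, so the term with r^2 forces r(x) =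
   0, and symmetrically. *)
have both x : x \in s -> root (l * r) x -> l.[x] = 0 /\ r.[x] = 0.
  move=> xs; have [h1 h1'] := hl x; have [h2 h2'] := hr x.
  rewrite /root => /eqP lr0; have := W x xs; rewrite lr0 mul0r.
  move=> /esym/eqP; rewrite -hornerM lr0 expr0n /= add0r.
  rewrite paddr_eq0 // !mulf_eq0 !orbb (gt_eqF bl0) (gt_eqF br0) /=.
  move=> /andP[/orP e1 /orP e2]; move: lr0 => /eqP; rewrite hornerM mulf_eq0.
  case/orP => /eqP z; split => //.
    by case: e1 => /eqP // w; have := h1' z; rewrite w ltxx.
  by case: e2 => /eqP // w; have := h2' z; rewrite w ltxx.
split.
- by rewrite monicMl.
- rewrite size_Mmonic ?monic_neq0 // sl sr scl scr; lia.
- by move=> x xs; rewrite W // addr_ge0 // addr_ge0 // sqr_ge0.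
- move=> x xs /(both x xs)[l0 r0].
  by rewrite /root derivM !hornerE l0 r0 mulr0 mul0r addr0.
- rewrite leq_min -scr -scl; apply/andP; split; rewrite -ltnS.
    rewrite -sl; apply: count_common_roots; rewrite ?monic_neq0 //.
    by move=> x xs /(both x xs)[/eqP].
  rewrite -sr; apply: count_common_roots; rewrite ?monic_neq0 //.
  by move=> x xs /(both x xs)[_ /eqP].
Qed.

Lemma perturbation_central_minor (R : realType) (N : nat) (n : 'I_N)
    (s hs : seq R) (K t : R) (J : 'M[R]_N) :
  sorted <%R s -> sorted <%R hs -> size s = N -> size hs = N -> 0 < t ->
  is_jacobi J -> is_spectrum s J ->
  is_spectrum hs (perturb n t ((t ^- 2 - 1) * K) J) ->
  exists q, central_minor s n q /\
    root_poly hs = t ^+ 2 *: root_poly s + (1 - t ^+ 2) *: (('X - K%:P) * q).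
Proof.
move=> /lt_sorted_uniq us /lt_sorted_uniq uh sN hN t0 /is_jacobi_ex[a [c [c0 ->]]].
move=> /(is_spectrum_char_poly _ us sN) P1 /(is_spectrum_char_poly _ uh hN) P2.
have tn0 : t != 0 by rewrite gt_eqF.
have := @char_poly_perturb R N n t K 1 a c tn0.
have := @jacobi_polys_center R a (coupling 1 c) n (N - n - 1).
rewrite {1}(_ : (n + _.+1)%N = N); last by have := ltn_ord n; lia.
rewrite -char_poly_jacobi_mx P1 P2.
have pos i := @coupling_gt0 R 1 c i ltr01 c0.
have := @central_minor_of_polys R s n (rev [seq (a i, coupling 1 c i) | i <- iota 0 n])
  [seq (a i, coupling 1 c i.+1) | i <- iota n.+1 (N - n - 1)] (a n)
  (coupling 1 c n) (coupling 1 c n.+1) us.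
rewrite -/(left_polys _ _ _) -/(right_polys _ _ _ _).
case: (left_polys _ _ _) => l l'; case: (right_polys _ _ _ _) => r r'.
move=> cm e1 e2; exists (l * r); split=> //; apply: cm => //.
- by rewrite sN.
- by rewrite size_rev size_map size_iota.
- by rewrite size_map size_iota sN.
- by move=> e; rewrite mem_rev => /mapP[i _ ->]; apply: pos.
- by move=> e /mapP[i _ ->]; apply: pos.
Qed.

Lemma central_minor_perturbation (R : realType) (N : nat) (n : 'I_N)
    (s hs : seq R) (K t : R) (q : {poly R}) :
  sorted <%R s -> sorted <%R hs -> size s = N -> size hs = N -> 0 < t ->
  central_minor s n q ->
  root_poly hs = t ^+ 2 *: root_poly s + (1 - t ^+ 2) *: (('X - K%:P) * q) ->
  exists J : 'M[R]_N, let Jt := perturb n t ((t ^- 2 - 1) * K) J in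
    [/\ is_jacobi J, is_jacobi Jt, is_spectrum s J & is_spectrum hs Jt].
Proof.
move=> ss hss sN hN t0 cm E.
have := central_minor_split ss _ cm; rewrite sN => /(_ (ltn_ord n)).
move=> [cl [cr [a0 [bl [br]]]]].
pose d : R * R := (0, 1).
(* The left list starts at index n - 1 and runs down, so index i reads position n - i - 1; the right
   list starts at n + 1. *)
pose a i := if (i < n)%N then (nth d cl (n - i.+1)).1 else
  if i == n :> nat then a0 else (nth d cr (i - n.+1)).1.
(* [b i] couples i - 1 and i. A right entry carries the coupling to its successor, hence the offset
   n + 2. The default (0, 1) keeps all values positive. *)
pose b i := if (i < n)%N then (nth d cl (n - i.+1)).2 else
  if i == n :> nat then bl else
  if i == n.+1 then br else (nth d cr (i - n.+2)).2.
pose c i := - Num.sqrt (b i.+1).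
case e1 : (jacobi_polys cl) => [l l']; case e2 : (jacobi_polys cr) => [r r'].
move=> [[scl scr] pos [bl0 br0] qE PE].
have b0 i : 0 < b i.
  have posn (cc : seq (R * R)) j : {subset cc <= cl ++ cr} -> 0 < (nth d cc j).2.
    move=> sub; have [jc|jc] := ltnP j (size cc).
      by apply: pos; apply: sub; rewrite mem_nth.
    by rewrite nth_default //=.
  rewrite /b; case: ifP => _; first by apply: posn => e; rewrite mem_cat => ->.
  case: ifP => // _; case: ifP => // _; apply: posn => e.
  by rewrite mem_cat orbC => ->.
have cb i : coupling (b 0) c i = b i.
  by case: i => // i; rewrite /= /c sqrrN sqr_sqrtr // ltW.
have c0 i : c i < 0 by rewrite oppr_lt0 sqrtr_gt0.
have lE : left_polys a (coupling (b 0) c) n = (l, l').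
  rewrite -e1 /left_polys; congr jacobi_polys.
  apply: (@eq_from_nth _ d); first by rewrite size_rev size_map size_iota scl.
  move=> i; rewrite size_rev size_map size_iota => ilt.
  rewrite nth_rev size_map size_iota // (nth_map 0%N) ?size_iota; last by lia.
  rewrite nth_iota; last by lia.
  rewrite cb /a /b add0n.
  have -> : (n - i.+1 < n)%N by lia.
  have -> : (n - (n - i.+1).+1)%N = i by lia.
  by case: (nth d cl i).
have rE : right_polys a (coupling (b 0) c) n.+1 (N - n - 1) = (r, r').
  rewrite -e2 /right_polys; congr jacobi_polys.
  apply: (@eq_from_nth _ d); first by rewrite size_map size_iota scr.
  move=> i; rewrite size_map size_iota => ilt.
  rewrite (nth_map 0%N) ?size_iota // nth_iota // cb /a /b.
  have -> : (n.+1 + i < n)%N = false by lia.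
  have -> : ((n.+1 + i).+1 < n)%N = false by lia.
  have -> : (n.+1 + i == n)%N = false by lia.
  have -> : ((n.+1 + i).+1 == n)%N = false by lia.
  have -> : ((n.+1 + i).+1 == n.+1)%N = false by lia.
  have -> : (n.+1 + i - n.+1)%N = i by lia.
  have -> : ((n.+1 + i).+1 - n.+2)%N = i by lia.
  by case: (nth d cr i).
have tn0 : t != 0 by rewrite gt_eqF.
have := @char_poly_perturb R N n t K (b 0) a c tn0.
have := @jacobi_polys_center R a (coupling (b 0) c) n (N - n - 1).
rewrite lE rE {1}(_ : (n + _.+1)%N = N); last by have := ltn_ord n; lia.
rewrite -char_poly_jacobi_mx !cb.
have -> : a n = a0 by rewrite /a ltnn eqxx.
have -> : b n = bl by rewrite /b ltnn eqxx.
have -> : b n.+1 = br by rewrite /b ltnNge leqnSn gtn_eqF // eqxx.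
rewrite -PE => P1; rewrite P1 -qE -E => P2.
exists (jacobi_mx N a c) => Jt.
have us := lt_sorted_uniq ss; have uh := lt_sorted_uniq hss.
split; first exact: is_jacobi_mx.
- rewrite /Jt perturb_jacobi_mx; apply: is_jacobi_mx => i.
  by case: ifP => _; rewrite ?pmulr_rlt0 // c0.
- exact/is_spectrum_char_poly.
- exact/is_spectrum_char_poly.
Qed.

(** * Root intervals *)

(** The positive product expresses strict betweenness without deciding which of a and c is
    larger. *)
Lemma root_strictly_between (R : realType) (p : {poly R}) a c :
  p.[a] * p.[c] < 0 -> exists2 x, root p x & 0 < (x - a) * (c - x).
Proof.
move=> h; have [ac|ac] := leP a c.
  have [x] := polyrcf.poly_ivtoo ac h; rewrite in_itv /= => /andP[h1 h2] rx.
  by exists x; rewrite ?mulr_gt0 ?subr_gt0.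
rewrite mulrC in h; have [x] := polyrcf.poly_ivtoo (ltW ac) h.
rewrite in_itv /= => /andP[h1 h2] rx.
by exists x => //; rewrite nmulr_rgt0 ?subr_lt0.
Qed.

(** S is a reference sign. If p vanishes at c, the sign of its derivative gives the sign of p just
    before c, so another zero is found at a or strictly between. *)
Lemma root_half_open (R : realType) (p : {poly R}) a c S :
  p.[a] * S * (c - a) <= 0 ->
  0 < p.[c] * S * (c - a) \/ (p.[c] = 0 /\ p^`().[c] * S < 0) ->
  exists2 x, root p x & x = a \/ 0 < (x - a) * (c - x).
Proof.
move=> ha hc; have [pa|pa] := eqVneq p.[a] 0.
  by exists a; [apply/eqP | left].
case: hc => [hc|[pc dc]].
  have [|x rx hx] := @root_strictly_between R p a c; last by exists x; [|right].
  have S2 : 0 < (S * (c - a)) ^+ 2.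
    rewrite exprn_even_gt0 //=; apply/eqP => e; move: hc.
    by rewrite -mulrA e mulr0 ltxx.
  have ha' : p.[a] * S * (c - a) < 0.
    rewrite lt_neqAle ha andbT -mulrA mulf_eq0 negb_or pa /=.
    by apply: contraTneq S2 => ->; rewrite expr0n ltxx.
  by rewrite -(pmulr_llt0 _ S2); move: (p.[a]) (p.[c]) hc ha' {ha S2} => A C; nra.
(* Dividing by X - c leaves g with g(c) = p'(c), and g has opposite signs at a and c. *)
have /factor_theorem[g gE] : root p c by apply/eqP.
have ac : (a - c) != 0.
  by apply: contraNneq pa => /subr0_eq ->; rewrite pc.
have [|x rx hx] := @root_strictly_between R g a c; last first.
  by exists x; [rewrite gE rootM rx | right].
have gc : p^`().[c] = g.[c].
  by rewrite gE derivM derivXsubC !hornerE subrr mulr0 add0r.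
rewrite gc in dc; have ha' : p.[a] * S * (c - a) < 0.
  rewrite lt_neqAle ha andbT !mulf_eq0 !negb_or pa -[_ - _]opprB oppr_eq0 ac andbT.
  by apply: contraTneq dc => ->; rewrite mulr0 ltxx.
have {ha ha'}ga : 0 < g.[a] * S.
  have ac2 : 0 < (a - c) ^+ 2 by rewrite exprn_even_gt0.
  rewrite -(pmulr_rgt0 _ ac2) -oppr_lt0; apply: le_lt_trans ha'.
  by rewrite gE !hornerE /= le_eqVlt; apply/orP; left; apply/eqP; ring.
have S2 : 0 < S ^+ 2.
  by rewrite exprn_even_gt0 //=; apply: contraTneq ga => ->; rewrite mulr0 ltxx.
rewrite -(pmulr_llt0 _ S2); have : (g.[a] * S) * (g.[c] * S) < 0.
  by rewrite pmulr_rlt0.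
by congr (_ < 0); ring.
Qed.

(** * Disjoint half-open slots pointing towards K *)

Lemma seq_min_ex (R : realType) (r : seq R) (P : pred R) x :
  x \in r -> P x ->
  exists c, [/\ c \in r, P c & forall y, y \in r -> P y -> c <= y].
Proof.
elim: r x => // a r IH x; rewrite inE => /orP[/eqP->|xr] Px.
  have [/hasP[y yr Py]|no] := boolP (has P r).
    have [c [cr Pc cm]] := IH y yr Py.
    have [ca|ac] := leP c a.
      by exists c; split; rewrite ?inE ?cr ?orbT // => z; rewrite inE => /orP[/eqP->|/cm].
    exists a; split; rewrite ?mem_head // => z; rewrite inE => /orP[/eqP->//|zr Pz].
    by rewrite (le_trans (ltW ac)) // cm.
  exists a; split; rewrite ?mem_head // => z; rewrite inE => /orP[/eqP->//|zr Pz].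
  by case/hasP: no; exists z.
have [c [cr Pc cm]] := IH x xr Px.
have [ca|ac] := leP c a.
  by exists c; split; rewrite ?inE ?cr ?orbT // => z; rewrite inE => /orP[/eqP->|/cm].
have [Pa|nPa] := boolP (P a).
  exists a; split; rewrite ?mem_head // => z; rewrite inE => /orP[/eqP->//|zr Pz].
  by rewrite (le_trans (ltW ac)) // cm.
exists c; split; rewrite ?inE ?cr ?orbT // => z; rewrite inE => /orP[/eqP->|/cm//].
by rewrite (negbTE nPa).
Qed.

(** The interval from l towards K, stopping short of the next point of s or of K. The slot of K
    itself is the single point K, so every element of s owns one. *)
Definition slot (R : realType) (s : seq R) (K l x : R) : bool :=
  if l < K then (l <= x < K) && all (fun y => (l < y) ==> (x < y)) s
  else if K < l then (K < x <= l) && all (fun y => (y < l) ==> (y < x)) s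
  else x == K.

Lemma slot_below (R : realType) (s : seq R) (K l x : R) : l < K ->
  slot s K l x <-> l <= x < K /\ {in s, forall y, l < y -> x < y}.
Proof.
move=> lK; rewrite /slot lK; split=> [/andP[h /allP a]|[h a]].
  by split=> // y ys; apply/implyP/a.
by rewrite h; apply/allP => y ys; apply/implyP/a.
Qed.

Lemma slot_above (R : realType) (s : seq R) (K l x : R) : K < l ->
  slot s K l x <-> K < x <= l /\ {in s, forall y, y < l -> y < x}.
Proof.
move=> lK; rewrite /slot ltNge ltW //= lK; split=> [/andP[h /allP a]|[h a]].
  by split=> // y ys; apply/implyP/a.
by rewrite h; apply/allP => y ys; apply/implyP/a.
Qed.

Lemma slot_self (R : realType) (s : seq R) (K x : R) : slot s K K x = (x == K).
Proof. by rewrite /slot ltxx. Qed.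

(** Slots on different sides of K are separated by K, those on the same side by whichever of l and
    l' is nearer to K. *)
Lemma slot_lt_absurd (R : realType) (s : seq R) (K l l' x : R) :
  l \in s -> l' \in s -> slot s K l x -> slot s K l' x -> l < l' -> False.
Proof.
move=> ls ls'; have [lK|lK|->] := ltgtP l K.
- move=> /(slot_below _ _ lK)[/andP[h1 h2] h3].
  have [lK'|lK'|->] := ltgtP l' K.
  + move=> /(slot_below _ _ lK')[/andP[h4 h5] h6] /(h3 _ ls'); lra.
  + move=> /(slot_above _ _ lK')[/andP[h4 h5] h6]; lra.
  + rewrite slot_self => /eqP; lra.
- move=> /(slot_above _ _ lK)[/andP[h1 h2] h3] + ll; have lK' : K < l' by lra.
  by move=> /(slot_above _ _ lK')[h4 /(_ _ ls ll)]; lra.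
- rewrite slot_self => /eqP -> + ll.
  by move=> /(slot_above _ _ ll)[]; lra.
Qed.

Lemma slot_inj (R : realType) (s : seq R) (K l l' x : R) :
  l \in s -> l' \in s -> slot s K l x -> slot s K l' x -> l = l'.
Proof.
move=> ls ls' h h'; have [ll|ll|//] := ltgtP l l'.
  by case: (slot_lt_absurd ls ls' h h' ll).
by case: (slot_lt_absurd ls' ls h' h ll).
Qed.

(** Disjointness makes the choice injective, and equal cardinalities make it exhaust [hs]. *)
Lemma slot_choice (R : realType) (s hs : seq R) (K : R) :
  uniq s -> uniq hs -> size s = size hs ->
  {in s, forall l, exists2 x, x \in hs & slot s K l x} ->
  exists f : R -> R, perm_eq [seq f l | l <- s] hs /\
    {in s, forall l, slot s K l (f l)}.
Proof.
move=> us uh sz h.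
have /choice[f hf] : forall l, exists x, l \in s -> x \in hs /\ slot s K l x.
  by move=> l; have [/h[x xh sx]|_] := boolP (l \in s); [exists x | exists 0].
exists f; split; last by move=> l /hf[].
have uf : uniq [seq f l | l <- s].
  rewrite map_inj_in_uniq // => l l' ls ls' e.
  have [_ h1] := hf _ ls; have [_ h2] := hf _ ls'.
  by apply: (slot_inj ls ls' h1); rewrite e.
have sub : {subset [seq f l | l <- s] <= hs}.
  by move=> x /mapP[l /hf[xh _] ->].
have le : (size hs <= size [seq f l | l <- s])%N by rewrite size_map sz.
have [_ e] := uniq_min_size uf sub le.
exact: uniq_perm.
Qed.

Lemma slot_unique (R : realType) (s hs : seq R) (K : R) :
  uniq s -> uniq hs -> size s = size hs ->
  {in s, forall l, exists2 x, x \in hs & slot s K l x} ->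
  {in s, forall l, exists! x, x \in hs /\ slot s K l x}.
Proof.
move=> us uh sz h l ls; have [f [pf hf]] := slot_choice us uh sz h.
have e x : x \in hs -> slot s K l x -> f l = x.
  rewrite -(perm_mem pf) => /mapP[l' ls' ->] sl.
  by rewrite (slot_inj ls ls' sl (hf _ ls')).
exists (f l); split; last by move=> x []; apply: e.
by split; [rewrite -(perm_mem pf) map_f | apply: hf].
Qed.

(** With f y the point in the slot of y, the expression is (l - f l) (l - K) times the product of
    the (l - f y) (l - y). No factor is negative, as l never lies strictly between y and f y. *)
Lemma slot_sign (R : realType) (s hs : seq R) (K : R) :
  uniq s -> uniq hs -> size s = size hs ->
  {in s, forall l, exists2 x, x \in hs & slot s K l x} ->
  {in s, forall l, 0 <= (root_poly hs).[l] * (root_poly s)^`().[l] * (l - K)}.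
Proof.
move=> us uh sz h l ls; have [f [pf hf]] := slot_choice us uh sz h.
rewrite deriv_root_poly // -(perm_root_poly pf) horner_root_poly big_map.
rewrite (bigD1_seq l) //= (_ : _ * _ * _ = (l - f l) * (l - K) *
    \prod_(y <- s | y != l) ((l - f y) * (l - y))); last first.
  by rewrite big_split /= horner_cofactor; ring.
rewrite mulr_ge0 //; last first.
  rewrite big_seq_cond; apply: prodr_ge0 => y /andP[ys yl]; have := hf _ ys.
  have [yK|yK|yK] := ltgtP y K.
  - move=> /(slot_below _ _ yK)[/andP[h1 h2] /(_ _ ls) h3].
    by have [/h3|ly|e] := ltgtP y l; [nra|nra|rewrite e eqxx in yl].
  - move=> /(slot_above _ _ yK)[/andP[h1 h2] /(_ _ ls) h3].
    by have [ly|/h3|e] := ltgtP y l; [nra|nra|rewrite e eqxx in yl].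
  - rewrite yK slot_self => /eqP->; nra.
have := hf _ ls; have [lK|lK|lK] := ltgtP l K.
- by move=> /(slot_below _ _ lK)[/andP[h1 h2] _]; nra.
- by move=> /(slot_above _ _ lK)[/andP[h1 h2] _]; nra.
- by rewrite lK subrr mulr0.
Qed.

(** * The rational function Nhat *)

Definition pencil (R : realType) (s hs : seq R) (K t : R) (q : {poly R}) :=
  root_poly hs = t *: root_poly s + (1 - t) *: (('X - K%:P) * q).

Lemma horner_pencil (R : realType) (s hs : seq R) (K t x : R) (q : {poly R}) :
  pencil s hs K t q ->
  (root_poly hs).[x] = t * (root_poly s).[x] + (1 - t) * ((x - K) * q.[x]).
Proof. by move=> ->; rewrite !hornerE. Qed.

Lemma deriv_pencil (R : realType) (s hs : seq R) (K t x : R) (q : {poly R}) :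
  pencil s hs K t q ->
  (root_poly hs)^`().[x] = t * (root_poly s)^`().[x]
    + (1 - t) * (q.[x] + (x - K) * q^`().[x]).
Proof.
by move=> ->; rewrite derivD !derivZ derivM derivXsubC !hornerE.
Qed.

(** Let c be the far end of the slot of l. Measured against P'(l), the sign of P^ at l is weakly
    opposite to its sign at c or, if P^(c) = 0, just before c; hence P^ has a zero in the slot. *)
Lemma slots_of_minor (R : realType) (s hs : seq R) (K t : R) (q : {poly R}) :
  uniq s -> 0 < t < 1 -> pencil s hs K t q ->
  {in s, forall x, 0 <= q.[x] * (root_poly s)^`().[x]} ->
  {in s, forall x, root q x -> root q^`() x} ->
  {in s, forall l, exists2 x, x \in hs & slot s K l x}.
Proof.
move=> us /andP[t0 t1] E sq dq l ls.
have rP x : x \in s -> (root_poly s).[x] = 0.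
  by rewrite -horner_root_poly0 => /eqP.
have [lK|lK] := eqVneq l K.
  exists K; last by rewrite lK slot_self.
  rewrite -horner_root_poly0 (horner_pencil _ E) -lK (rP _ ls).
  by rewrite subrr mul0r !mulr0 addr0.
set S := (root_poly s)^`().[l].
have sgnl c : 0 < (c - l) * (K - l) -> (root_poly hs).[l] * S * (c - l) <= 0.
  move=> cl; rewrite (horner_pencil _ E) (rP _ ls) mulr0 add0r.
  have := sq l ls; rewrite -/S => qS.
  rewrite [X in X <= _](_ : _ = - ((1 - t) * (q.[l] * S) * ((c - l) * (K - l)))).
    rewrite oppr_le0 mulr_ge0 ?(ltW cl) // mulr_ge0 //.
    by rewrite subr_ge0 ltW.
  by ring.
(* The hypotheses say that c lies from l towards K, not beyond K, with no other element of s in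
   between. *)
have sgnc c : c \in K :: s -> 0 < (c - l) * (K - l) -> 0 <= (K - c) * (c - l) ->
    (forall y, y \in s -> y != l -> y != c -> 0 < (l - y) * (c - y)) ->
    0 < (root_poly hs).[c] * S * (c - l) \/
    ((root_poly hs).[c] = 0 /\ (root_poly hs)^`().[c] * S < 0).
  move=> cKs cl Kc adj; have [cs|cs] := boolP (c \in s); last first.
    have cK : c = K by move: cKs; rewrite inE (negbTE cs) orbF => /eqP.
    left; rewrite (horner_pencil _ E) cK subrr mul0r mulr0 addr0.
    rewrite /S deriv_root_poly // (root_poly_cofactor us ls) hornerM hornerXsubC.
    have := @cofactor_same_sign R s l K; set u := _.[l]; set v := _.[K] => uv.
    rewrite [X in 0 < X](_ : _ = t * (K - l) ^+ 2 * (u * v)); last by ring.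
    rewrite mulr_gt0 //; last first.
      by apply: uv => y ys yl; rewrite -cK adj //; apply: contraNneq cs => <-.
    by rewrite mulr_gt0 // exprn_even_gt0 //= subr_eq0 eq_sym.
  have lc : l != c by apply: contraTneq cl => ->; rewrite subrr mul0r ltxx.
  have := deriv_adjacent_roots us ls cs lc adj; rewrite -/S.
  set T := (root_poly s)^`().[c] => ST.
  have T2 : 0 < T ^+ 2.
    by rewrite exprn_even_gt0 //=; apply: contraTneq ST => ->; rewrite mulr0 ltxx.
  have dneg : 0 < (root_poly hs)^`().[c] * T -> (root_poly hs)^`().[c] * S < 0.
    move=> h; rewrite -(pmulr_llt0 _ T2).
    rewrite [X in X < _](_ : _ = (root_poly hs)^`().[c] * T * (S * T)); last by ring.
    by rewrite pmulr_rlt0.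
  have T0 : 0 < t * T * T by rewrite -mulrA -expr2 mulr_gt0.
  (* If c = K is in s, then P^ vanishes there and its derivative t P' + (1 - t) q has the sign of
     P'(c), opposite to P'(l). *)
  have [cK|cK] := eqVneq c K.
    right; split.
      by rewrite (horner_pencil _ E) (rP _ cs) cK subrr mul0r !mulr0 addr0.
    apply: dneg; rewrite (deriv_pencil _ E) cK subrr mul0r addr0 mulrDl.
    by rewrite -cK -/T ltr_pwDl // -mulrA mulr_ge0 ?sq // subr_ge0 ltW.
  (* A common zero of P and q is double for q, so the derivative of P^ is t P' there. *)
  have [qc|qc] := eqVneq q.[c] 0.
    right; split.
      by rewrite (horner_pencil _ E) (rP _ cs) qc !mulr0 addr0.
    apply: dneg; rewrite (deriv_pencil _ E) qc.
    have /eqP -> : root q^`() c by apply: dq => //; apply/eqP.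
    by rewrite mulr0 addr0 mulr0 addr0.
  left; rewrite (horner_pencil _ E) (rP _ cs) mulr0 add0r.
  have qT : 0 < q.[c] * T.
    rewrite lt_neqAle sq // andbT eq_sym mulf_neq0 //.
    by apply: contraTneq T2 => ->; rewrite expr0n ltxx.
  have Kc' : 0 < (K - c) * (c - l).
    by rewrite lt_neqAle Kc andbT eq_sym mulf_neq0 // subr_eq0 eq_sym.
  rewrite -(pmulr_lgt0 _ T2).
  rewrite [X in 0 < X](_ : _ =
     (1 - t) * (q.[c] * T) * ((K - c) * (c - l)) * - (S * T)); last by ring.
  rewrite mulr_gt0 ?oppr_gt0 // mulr_gt0 // mulr_gt0 //.
  by rewrite subr_gt0.
have fin c : c \in K :: s -> 0 < (c - l) * (K - l) -> 0 <= (K - c) * (c - l) ->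
    (forall y, y \in s -> y != l -> y != c -> 0 < (l - y) * (c - y)) ->
    exists2 x, x \in hs & x = l \/ 0 < (x - l) * (c - x).
  move=> c1 c2 c3 c4.
  have [x] := root_half_open (sgnl c c2) (sgnc c c1 c2 c3 c4).
  by rewrite root_root_poly => xh hx; exists x.
have [ltK|ltK|e] := ltgtP l K; last by rewrite e eqxx in lK.
  have [c [c1 c2 c3]] := @seq_min_ex R (K :: s) (fun y => l < y) K (mem_head _ _) ltK.
  have cK : c <= K by apply: c3; rewrite ?mem_head.
  have cs y : y \in s -> l < y -> c <= y by move=> ys; apply: c3; rewrite inE ys orbT.
  have [|||x xh hx] := fin c c1; [by nra|by nra| |].
    move=> y ys yl yc; have [ly|ly|e] := ltgtP y l; [by nra| |by rewrite e eqxx in yl].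
    by have := cs y ys ly; rewrite le_eqVlt eq_sym (negbTE yc) /=; nra.
  exists x => //; apply/(slot_below _ _ ltK).
  have xc : l <= x < c by case: hx => [->|]; [rewrite lexx c2 | move=> h; nra].
  case/andP: xc => lx xc; split; first by rewrite lx (lt_le_trans xc).
  by move=> y ys /(cs y ys); apply: lt_le_trans.
(* The largest element below l is the negative of a minimum of the negated list. *)
have [c [c1 c2 c3]] : exists c, [/\ c \in K :: s, c < l &
    forall y, y \in K :: s -> y < l -> y <= c].
  have nK : - l < - K by rewrite ltrN2.
  have [_ [/mapP[c cs ->] c2 c3]] :=
    @seq_min_ex R (map -%R (K :: s)) (fun y => - l < y) (- K) (mem_head _ _) nK.
  exists c; split=> // [|y ys yl]; first by rewrite -ltrN2.
  by rewrite -lerN2 c3 ?map_f // ltrN2.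
have cK : K <= c by apply: c3; rewrite ?mem_head.
have cs y : y \in s -> y < l -> y <= c by move=> ys; apply: c3; rewrite inE ys orbT.
have [|||x xh hx] := fin c c1; [by nra|by nra| |].
  move=> y ys yl yc; have [ly|ly|e] := ltgtP y l; [ |by nra|by rewrite e eqxx in yl].
  by have := cs y ys ly; rewrite le_eqVlt (negbTE yc) /=; nra.
exists x => //; apply/(slot_above _ _ ltK).
have xc : c < x <= l by case: hx => [->|]; [rewrite lexx c2 | move=> h; nra].
case/andP: xc => lx xc; split; first by rewrite xc (le_lt_trans cK).
by move=> y ys /(cs y ys) h; apply: le_lt_trans lx.
Qed.

Lemma Nhat_num_gcd (R : realType) (s hs : seq R) :
  root_poly hs = Nhat_num s hs * gcdp (root_poly hs) (root_poly s).
Proof. by rewrite divpK ?dvdp_gcdl. Qed.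

Lemma Nhat_den_gcd (R : realType) (s hs : seq R) :
  root_poly s = Nhat_den s hs * gcdp (root_poly hs) (root_poly s).
Proof. by rewrite divpK ?dvdp_gcdr. Qed.

Lemma Nhat_regular (R : realType) (s hs : seq R) x : x \notin s ->
  Nhat s hs x = (root_poly hs).[x] / (root_poly s).[x].
Proof.
have E1 := Nhat_den_gcd s hs; have E2 := Nhat_num_gcd s hs.
move: (gcdp _ _) E1 E2 => g E1 E2.
rewrite -horner_root_poly0 E1 hornerM mulf_eq0 negb_or => /andP[d0 g0].
by rewrite /Nhat E2 hornerM; field; rewrite d0 g0.
Qed.

(** The zero x of P is simple, so P'(x), the reduced denominator times h at x, is nonzero; hence so
    are both factors. *)
Lemma Nhat_common_factor (R : realType) (s hs : seq R) x :
  uniq s -> x \in s -> x \in hs ->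
  exists h : {poly R}, [/\ h.[x] != 0, (Nhat_den s hs).[x] != 0,
    root_poly s = Nhat_den s hs * h * ('X - x%:P)
    & root_poly hs = Nhat_num s hs * h * ('X - x%:P)].
Proof.
move=> us xs xh; have /factor_theorem[h hE] :
    root (gcdp (root_poly hs) (root_poly s)) x.
  by rewrite root_gcd !root_root_poly xs xh.
have E1 : root_poly s = Nhat_den s hs * h * ('X - x%:P).
  by rewrite {1}(Nhat_den_gcd s hs) hE mulrA.
have E2 : root_poly hs = Nhat_num s hs * h * ('X - x%:P).
  by rewrite {1}(Nhat_num_gcd s hs) hE mulrA.
exists h; have := deriv_root_poly_neq0 us xs.
rewrite {1}E1 derivM derivXsubC !hornerE subrr mulr0 add0r mulf_eq0 negb_or.
by case/andP.
Qed.

(** The derivatives at x are the reduced numerator and denominator times the same nonzero h(x). *)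
Lemma Nhat_common (R : realType) (s hs : seq R) x :
  uniq s -> x \in s -> x \in hs ->
  Nhat s hs x = (root_poly hs)^`().[x] / (root_poly s)^`().[x].
Proof.
move=> us xs xh; have [h [h0 d0 -> ->]] := Nhat_common_factor us xs xh.
rewrite !derivM !derivXsubC !hornerE subrr !mulr0 !add0r /Nhat.
by field; rewrite h0 d0.
Qed.

Lemma derive1_Nhat (R : realType) (s hs : seq R) x : (Nhat_den s hs).[x] != 0 ->
  derive1 (Nhat s hs) x =
    ((Nhat_num s hs)^`().[x] * (Nhat_den s hs).[x]
     - (Nhat_num s hs).[x] * (Nhat_den s hs)^`().[x]) / (Nhat_den s hs).[x] ^+ 2.
Proof.
move=> d0; rewrite derive1E /Nhat.
have dn := is_derive_poly (Nhat_num s hs) x.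
have dd := is_derive_poly (Nhat_den s hs) x.
have dv := @is_deriveV R (horner (Nhat_den s hs)) x _ 1 d0 dd.
have dm := is_deriveM dn dv.
rewrite (_ : (fun y => _) = horner (Nhat_num s hs) * (fun y => (Nhat_den s hs).[y]^-1)) //.
rewrite derive_val.
by rewrite /GRing.scale /=; field.
Qed.

(** With d the reduced denominator, N^ - t = (1 - t) q / (d h) near K. As q(K) = 0, its derivative
    at K is a nonzero multiple of q'(K). *)
Lemma derive1_Nhat_common (R : realType) (s hs : seq R) (K t : R) (q : {poly R}) :
  uniq s -> K \in s -> K \in hs -> t < 1 -> pencil s hs K t q -> q.[K] = 0 ->
  (derive1 (Nhat s hs) K == 0) = root q^`() K.
Proof.
move=> us Ks Kh t1 E qK.
have [h [h0 d0 sE hsE]] := Nhat_common_factor us Ks Kh.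
have qE : (Nhat_num s hs - t *: Nhat_den s hs) * h = (1 - t) *: q.
  have /mulIf : 'X - K%:P != 0 by rewrite polyXsubC_eq0.
  apply; have := E; rewrite /pencil sE hsE -!mul_polyC => E'.
  rewrite mulrBl mulrBl E'; ring.
have t10 : 1 - t != 0 by rewrite subr_eq0 eq_sym lt_eqF.
have nK : (Nhat_num s hs).[K] = t * (Nhat_den s hs).[K].
  have /eqP := congr1 (fun p : {poly R} => p.[K]) qE.
  rewrite !hornerE qK mulr0 mulf_eq0 (negbTE h0) orbF subr_eq0.
  by move=> /eqP.
have := congr1 (fun p : {poly R} => p^`().[K]) qE.
rewrite derivM derivB !derivZ !hornerE nK subrr mul0r addr0 => dE.
have -> : derive1 (Nhat s hs) K =
    ((Nhat_num s hs)^`().[K] - t * (Nhat_den s hs)^`().[K]) / (Nhat_den s hs).[K].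
  by rewrite derive1_Nhat // nK; field.
rewrite mulf_eq0 invr_eq0 (negbTE d0) orbF /root.
have := congr1 (eq_op^~ 0) dE; rewrite /= !mulf_eq0 (negbTE h0) (negbTE t10) orbF.
by move=> ->.
Qed.

(** P^ - t P vanishes at K and has leading coefficient 1 - t; dividing it by (1 - t) (X - K) gives
    q. *)
Lemma pencil_exists (R : realType) (s hs : seq R) (K t : R) :
  size s = size hs -> (0 < size s)%N -> t < 1 ->
  (root_poly hs).[K] = t * (root_poly s).[K] ->
  exists q, [/\ pencil s hs K t q, q \is monic & size q = size s].
Proof.
move=> sz s0 t1 hK; have t10 : 1 - t != 0 by rewrite subr_eq0 eq_sym lt_eqF.
pose p := (1 - t)^-1 *: (root_poly hs - t *: root_poly s).
have /factor_theorem[q pE] : root p K by rewrite /root /p !hornerE hK subrr mulr0.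
have sp : (size p <= (size s).+1)%N.
  rewrite (leq_trans (size_scale_leq _ _)) // (leq_trans (size_polyD _ _)) //.
  rewrite size_polyN geq_max size_root_poly sz leqnn /=.
  by rewrite (leq_trans (size_scale_leq _ _)) // size_root_poly sz.
have lead r : (root_poly r : {poly R})`_(size r) = 1.
  by have := monicP (monic_root_poly r); rewrite /lead_coef size_root_poly.
have cp : p`_(size s) = 1.
  rewrite /p coefZ coefB coefZ lead [X in _`_X]sz lead mulr1.
  by field.
have sp' : size p = (size s).+1.
  apply/anti_leq; rewrite sp ltnNge; apply/negP => le.
  by move: cp; rewrite nth_default // => /esym/eqP; rewrite oner_eq0.
have mp : p \is monic by rewrite monicE /lead_coef sp' cp.
exists q; split.
- rewrite /pencil [_ * q]mulrC -pE /p scalerA divff // scale1r.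
  by rewrite addrC subrK.
- by rewrite -(monicMr _ (monicXsubC K)) -pE.
- have q0 : q != 0.
    apply: contraTneq mp => q0.
    by rewrite pE q0 mul0r monicE lead_coef0 eq_sym oner_eq0.
  by have := sp'; rewrite pE size_Mmonic ?monicXsubC // size_XsubC addn2 => -[].
Qed.

(** * Reading the conditions on N^ as properties of q *)

Lemma root_pencil (R : realType) (s hs : seq R) (K t x : R) (q : {poly R}) :
  t < 1 -> pencil s hs K t q -> x \in s -> x != K -> root q x = (x \in hs).
Proof.
move=> t1 E xs xK; rewrite -[x \in hs]horner_root_poly0 (horner_pencil _ E).
have /eqP -> : (root_poly s).[x] == 0 by rewrite horner_root_poly0.
rewrite mulr0 add0r !mulf_eq0 !subr_eq0 (negbTE xK) /= eq_sym lt_eqF //=.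
Qed.

(** On s the zeros of q are the points of mu and possibly K. This extra zero is the reason for the
    strict inequality in alternative b) of IV. *)
Lemma count_roots_pencil (R : realType) (s hs mu : seq R) (K t : R)
    (q : {poly R}) :
  uniq s -> is_common s hs K mu -> t < 1 -> pencil s hs K t q ->
  count (root q) s = (size mu + ((K \in s) && root q K))%N.
Proof.
move=> us [umu muE] t1 E.
have mE x : (x \in mu) = [&& x \in s, root q x & x != K].
  rewrite muE inE; have [xs|//] := boolP (x \in s).
  by have [->|xK] := eqVneq x K; rewrite ?andbF // !andbT (root_pencil t1 E).
rewrite -size_filter.
have [/andP[Ks qK]|nK] := boolP ((K \in s) && root q K).
  rewrite addn1 -[_.+1]/(size (K :: mu)); apply: perm_size; apply: uniq_perm.
  - exact: filter_uniq.
  - by rewrite /= mE eqxx !andbF.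
  - move=> x; rewrite mem_filter inE mE; have [->|] := eqVneq x K.
      by rewrite Ks qK.
    by rewrite andbT andbC.
rewrite addn0; apply: perm_size; apply: uniq_perm => //; first exact: filter_uniq.
move=> x; rewrite mem_filter mE; have [->|] := eqVneq x K.
  by rewrite !andbF andbC; apply/negbTE.
by rewrite andbT andbC.
Qed.

Lemma Nhat_pencil (R : realType) (s hs : seq R) (K t : R) (q : {poly R}) :
  uniq s -> pencil s hs K t q -> K \in s -> K \in hs ->
  Nhat s hs K = t + (1 - t) * (q.[K] / (root_poly s)^`().[K]).
Proof.
move=> us E Ks Kh; rewrite Nhat_common // (deriv_pencil _ E) subrr mul0r addr0.
by field; rewrite deriv_root_poly_neq0.
Qed.

(** N^ - t is a nonzero multiple of q' at the points of mu, and at K, if K is in both spectra, it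
    has the sign of q P'. So the conditions say that common zeros are double and bound their number,
    while the slots give the sign conditions away from K. *)
Lemma central_minor_iff (R : realType) (s hs mu : seq R) (K t : R) (n : nat) :
  uniq s -> uniq hs -> size s = size hs -> (0 < size s)%N ->
  is_common s hs K mu -> 0 < t < 1 ->
  (exists q, central_minor s n q /\ pencil s hs K t q) <->
  [/\ {in s, forall l, exists2 x, x \in hs & slot s K l x},
      {in mu, forall m, Nhat s hs m = t},
      ~~ ((K \in s) || (K \in hs)) ->
        (size mu <= minn n (size s - n - 1))%N /\ Nhat s hs K = t
    & (K \in s) || (K \in hs) ->
        (K \in s) && (K \in hs) /\
        ((size mu <= minn n (size s - n - 1))%N /\ Nhat s hs K > t \/
         [/\ (size mu < minn n (size s - n - 1))%N, Nhat s hs K = t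
           & derive1 (Nhat s hs) K = 0])].
Proof.
move=> us uh sz s0 cmu t01; have /andP[t0 t1] := t01.
have t10 : 0 < 1 - t by rewrite subr_gt0.
have dP x : x \in s -> (root_poly s)^`().[x] != 0 by apply: deriv_root_poly_neq0.
have P0 x : x \in s -> (root_poly s).[x] = 0 by rewrite -horner_root_poly0 => /eqP.
split.
  move=> [q [[mq sq posq dq cq] E]]; have cE := count_roots_pencil us cmu t1 E.
  (* As t is nonzero, this puts K into both spectra or into neither. *)
  have hK : (root_poly hs).[K] = t * (root_poly s).[K].
    by rewrite (horner_pencil _ E) subrr mul0r mulr0 addr0.
  split.
  - exact: slots_of_minor t01 E posq dq.
  - move=> m; rewrite (proj2 cmu) inE => /and3P[ms mh mK].
    have rm : root q m by rewrite (root_pencil t1 E).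
    rewrite Nhat_common // (deriv_pencil _ E) (eqP rm) (eqP (dq m ms rm)).
    by rewrite mulr0 addr0 mulr0 addr0 mulfK // dP.
  - rewrite negb_or => /andP[Ks Kh]; move: cq; rewrite cE (negbTE Ks) addn0 => cq.
    by rewrite Nhat_regular // hK mulfK // horner_root_poly0.
  - move=> KK; have [Ks Kh] : K \in s /\ K \in hs.
      have e : (K \in hs) = (K \in s).
        by rewrite -!horner_root_poly0 hK mulf_eq0 (gt_eqF t0).
      by move: KK; rewrite e orbb.
    rewrite Ks Kh; split=> //; rewrite (Nhat_pencil us E Ks Kh).
    (* A zero of q at K takes one of the admissible common zeros and gives b); otherwise q(K) P'(K)
       > 0 gives a). *)
    have [qK|qK] := boolP (root q K); [right|left].
      move: cq; rewrite cE Ks qK addn1 => cq; rewrite (eqP qK) mul0r mulr0 addr0.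
      split=> //; apply/eqP; rewrite (derive1_Nhat_common us Ks Kh t1 E (eqP qK)).
      exact: dq.
    move: cq; rewrite cE (negbTE qK) andbF addn0 => cq; split=> //.
    rewrite ltrDl mulr_gt0 //.
    have d2 : 0 < (root_poly s)^`().[K] ^+ 2 by rewrite exprn_even_gt0 //= dP.
    have -> : q.[K] / (root_poly s)^`().[K] =
      q.[K] * (root_poly s)^`().[K] / (root_poly s)^`().[K] ^+ 2.
      by field; rewrite dP.
    rewrite divr_gt0 // lt_neqAle posq // andbT eq_sym mulf_neq0 //.
    exact: dP.
move=> [hslot hmu h3 h4].
have hK : (root_poly hs).[K] = t * (root_poly s).[K].
  have [KK|KK] := boolP ((K \in s) || (K \in hs)).
    have [/andP[Ks Kh] _] := h4 KK.
    by rewrite P0 // mulr0; apply/eqP; rewrite horner_root_poly0.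
  have [_] := h3 KK; move: KK; rewrite negb_or => /andP[Ks Kh].
  by rewrite Nhat_regular // => <-; rewrite divfK // horner_root_poly0.
have [q [E mq sq]] := pencil_exists sz s0 t1 hK; exists q; split=> //.
have sgn := slot_sign us uh sz hslot.
have h4' : K \in s -> K \in hs /\ 0 <= q.[K] * (root_poly s)^`().[K] /\
    (if root q K then (size mu < minn n (size s - n - 1))%N /\ root q^`() K
     else (size mu <= minn n (size s - n - 1))%N).
  move=> Ks; have [|/andP[_ Kh] h] := h4; first by rewrite Ks.
  have d2 : 0 < (root_poly s)^`().[K] ^+ 2 by rewrite exprn_even_gt0 //= dP.
  have nE : q.[K] * (root_poly s)^`().[K] =
      (1 - t)^-1 * (root_poly s)^`().[K] ^+ 2 * (Nhat s hs K - t).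
    by rewrite (Nhat_pencil us E Ks Kh); field; rewrite dP // gt_eqF.
  split=> //; split.
    rewrite nE mulr_ge0 //; first by rewrite mulr_ge0 ?sqr_ge0 // invr_ge0 ltW.
    by rewrite subr_ge0; case: h => [[_ /ltW]|[_ ->]].
  case: h => [[cm lt]|[cm Nt dN]].
    case: ifP => // /eqP qK; move: lt; rewrite (Nhat_pencil us E Ks Kh) qK.
    by rewrite mul0r mulr0 addr0 ltxx.
  case: ifP => qK; last exact: ltnW.
  by split=> //; rewrite -(derive1_Nhat_common us Ks Kh t1 E (eqP qK)) dN.
split=> //.
- move=> x xs; have [xK|xK] := eqVneq x K.
    by rewrite xK in xs *; have [_ []] := h4' xs.
  have xK2 : 0 < (1 - t) * (x - K) ^+ 2.
    by rewrite mulr_gt0 // exprn_even_gt0 //= subr_eq0.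
  have := sgn x xs; rewrite (horner_pencil _ E) P0 // mulr0 add0r.
  rewrite [X in 0 <= X -> _](_ : _ =
    (1 - t) * (x - K) ^+ 2 * (q.[x] * (root_poly s)^`().[x])); last by ring.
  by rewrite pmulr_rge0.
- move=> x xs qx; have [xK|xK] := eqVneq x K.
    by rewrite xK in xs qx *; have [_ [_]] := h4' xs; rewrite qx => -[].
  have xh : x \in hs by rewrite -(root_pencil t1 E).
  (* The equation N^(x) = t cancels t P' in the derivative of P^, leaving (x - K) q'(x) = 0. *)
  have := hmu x; rewrite (proj2 cmu) inE xs xh xK => /(_ isT).
  rewrite Nhat_common // => /(canRL (mulfVK (dP x xs))).
  rewrite (deriv_pencil _ E) (eqP qx) add0r => /eqP.
  by rewrite -subr_eq0 addrAC subrr add0r !mulf_eq0 (gt_eqF t10) subr_eq0 (negbTE xK).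
- rewrite (count_roots_pencil us cmu t1 E).
  have [Ks|Ks] := boolP (K \in s).
    have [_ [_]] := h4' Ks; case: (root q K) => [[]|]; rewrite ?addn1 ?addn0 //.
  rewrite addn0; have [Kh|Kh] := boolP (K \in hs).
    by have [|] := h4; [rewrite Kh orbT | rewrite (negbTE Ks)].
  by have [|] := h3; rewrite // (negbTE Ks) (negbTE Kh).
Qed.

(** * Interlacing *)

Lemma elambda_nth (R : realType) (s : seq R) i :
  (i < size s)%N -> elambda s i.+1 = (nth 0 s i)%:E.
Proof. by move=> si; rewrite /elambda /= (nth_map 0). Qed.

Lemma elambda_size (R : realType) (s : seq R) : elambda s (size s).+1 = +oo%E.
Proof. by rewrite /elambda /= nth_default // size_map. Qed.

(** p counts the elements of s below K; the position i, counted from 0, holds lambda_(i+1). *)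
Lemma lt_nth_elambda (R : realType) (s : seq R) (K : R) p i :
  sorted <%R s -> (p <= size s)%N ->
  (elambda s p < K%:E <= elambda s p.+1)%E -> (i < size s)%N ->
  (nth 0 s i < K) = (i < p)%N.
Proof.
move=> ss ps /andP[h1 h2] si.
have mono j k : (j < size s)%N -> (k < size s)%N ->
    (nth 0 s j <= nth 0 s k) = (j <= k)%N.
  by move=> js ks; rewrite (lt_sorted_leq_nth 0 ss).
have [ip|pi] := ltnP i p.
  case: p ps h1 h2 ip => // p ps h1 _ ip.
  rewrite elambda_nth // lte_fin in h1.
  by rewrite (le_lt_trans _ h1) // mono.
apply/negbTE; rewrite -leNgt; have {}ps : (p < size s)%N by lia.
rewrite elambda_nth // lee_fin in h2.
by rewrite (le_trans h2) // mono.
Qed.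

Lemma elambda_split_ex (R : realType) (s : seq R) (K : R) : sorted <%R s ->
  exists2 p, (p <= size s)%N & (elambda s p < K%:E <= elambda s p.+1)%E.
Proof.
move=> ss; exists (find (fun y => K <= y) s); first exact: find_size.
apply/andP; split.
  case e : (find _ s) => [|p]; first by rewrite /elambda /= ltNyr.
  have ps : (p < size s)%N by rewrite (leq_trans _ (find_size (fun y => K <= y) s)) ?e.
  rewrite elambda_nth // lte_fin ltNge.
  have := @before_find _ 0 (fun y => K <= y) s p.
  by rewrite e => /(_ (ltnSn p)) ->.
have [h|h] := boolP (has (fun y => K <= y) s).
  by rewrite elambda_nth -?has_find // lee_fin; apply: (nth_find 0 h).
by rewrite hasNfind // elambda_size leey.
Qed.

Lemma one_in_slot (R : realType) (s hs : seq R) (K l : R)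
    (I : interval (\bar R)) :
  (forall x, slot s K l x <-> x%:E \in I) ->
  one_in hs I <-> exists! x, x \in hs /\ slot s K l x.
Proof.
by move=> h; split=> -[x [[xh sx] u]]; exists x; split;
  [split=> //; apply/h | move=> y [yh /h yI]; apply: u
  |split=> //; apply/h | move=> y [yh /h yI]; apply: u].
Qed.

(** Each interval of the condition is the slot of one of its ends, the left one below K and the
    right one above. The exclusion of l = K matches the case in which (K, lambda_(p+1)] is empty. *)
Lemma interlacing_slot (R : realType) (s hs : seq R) (K : R) :
  sorted <%R s ->
  interlacing (size s) s hs K <->
  {in s, forall l, l != K -> exists! x, x \in hs /\ slot s K l x}.
Proof.
move=> ss.
have mono j k : (j < size s)%N -> (k < size s)%N ->
    (nth 0 s j < nth 0 s k) = (j < k)%N.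
  by move=> js ks; rewrite (lt_sorted_ltn_nth 0 ss).
have monoW j k : (j < size s)%N -> (k < size s)%N ->
    (nth 0 s j <= nth 0 s k) = (j <= k)%N.
  by move=> js ks; rewrite (lt_sorted_leq_nth 0 ss).
(* Proved for every admissible p, which serves both directions of the existential. *)
suff slots p : (p <= size s)%N -> (elambda s p < K%:E <= elambda s p.+1)%E ->
    [/\ forall j, (1 <= j < p)%N -> one_in hs `[elambda s j, elambda s j.+1[,
        forall j, (p < j < size s)%N -> one_in hs `]elambda s j, elambda s j.+1],
        (1 <= p)%N -> one_in hs `[elambda s p, K%:E[
      & (p < size s)%N -> (K%:E < elambda s p.+1)%E ->
        one_in hs `]K%:E, elambda s p.+1] ] <->
    {in s, forall l, l != K -> exists! x, x \in hs /\ slot s K l x}.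
  split; first by move=> [p [ps hp]] /(slots p ps hp).
  have [p ps hp] := elambda_split_ex K ss.
  by move=> h; exists p; split=> //; apply/(slots p ps hp).
move=> ps hp; have ltp i si := @lt_nth_elambda R s K p i ss ps hp si.
(* [E1] and [E2] describe the slots below K, [E3] and [E4] those above; [E2] and [E4] are the two
   that reach K. *)
have E1 i x : (i.+1 < p)%N ->
    slot s K (nth 0 s i) x <-> x%:E \in `[elambda s i.+1, elambda s i.+2[.
  move=> ip; have i1s : (i.+1 < size s)%N by lia.
  have si := ltnW i1s; have iK : nth 0 s i < K by rewrite ltp // ltnW.
  have i1K : nth 0 s i.+1 < K by rewrite ltp.
  rewrite !elambda_nth // in_itv /= lee_fin lte_fin.
  split=> [/(slot_below _ _ iK)[/andP[-> _] h]|/andP[h1 h2]].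
    by apply: h; rewrite ?mem_nth // mono.
  apply/(slot_below _ _ iK); rewrite h1 (lt_trans h2) //; split=> // y ys iy.
  by rewrite (lt_le_trans h2) // sorted_nth_between.
have E2 i x : i.+1 = p ->
    slot s K (nth 0 s i) x <-> x%:E \in `[elambda s p, K%:E[.
  move=> ip; have si : (i < size s)%N by rewrite ip.
  have iK : nth 0 s i < K by rewrite ltp // ip.
  rewrite -ip elambda_nth // in_itv /= lee_fin lte_fin.
  split=> [/(slot_below _ _ iK)[]//|/andP[h1 h2]].
  apply/(slot_below _ _ iK); rewrite h1 h2; split=> // y /(nthP 0)[j js <-].
  rewrite mono // -ltnS ip ltnS => pj; rewrite (lt_le_trans h2) // leNgt.
  by rewrite ltp // -leqNgt.
have E3 i x : (p < i < size s)%N ->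
    slot s K (nth 0 s i) x <-> x%:E \in `]elambda s i, elambda s i.+1].
  case: i => // i /andP[pi i1s]; rewrite ltnS in pi; have si := ltnW i1s.
  have Ki : K <= nth 0 s i by rewrite leNgt ltp // -leqNgt.
  have Ki1 : K < nth 0 s i.+1 by rewrite (le_lt_trans Ki) // mono.
  rewrite !elambda_nth // in_itv /= lee_fin lte_fin.
  split=> [/(slot_above _ _ Ki1)[/andP[_ ->] h]|/andP[h1 h2]].
    by rewrite andbT; apply: h; rewrite ?mem_nth // mono.
  apply/(slot_above _ _ Ki1); rewrite h2 (le_lt_trans Ki) //; split=> // y.
  move=> /(nthP 0)[j js <-]; rewrite mono // ltnS => ji.
  by rewrite (le_lt_trans _ h1) // monoW.
have E4 x : (p < size s)%N -> K < nth 0 s p ->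
    slot s K (nth 0 s p) x <-> x%:E \in `]K%:E, elambda s p.+1].
  move=> sp Kp; rewrite elambda_nth // in_itv /= lee_fin lte_fin.
  split=> [/(slot_above _ _ Kp)[]//|/andP[h1 h2]].
  apply/(slot_above _ _ Kp); rewrite h1 h2; split=> // y /(nthP 0)[j js <-].
  by rewrite mono // -ltp // => jK; rewrite (lt_trans jK).
split=> [[h1 h2 h3 h4] l /(nthP 0)[i si <-] lK|h].
  have [ip|pi|ip] := ltngtP i p.
  - have [i1p|i1p] := ltnP i.+1 p.
      by apply/(one_in_slot hs (fun x => E1 i x i1p)); apply: h1.
    have {i1p}i1p : i.+1 = p by lia.
    by apply/(one_in_slot hs (fun x => E2 i x i1p)); apply: h3; lia.
  - have pis : (p < i < size s)%N by rewrite pi.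
    by apply/(one_in_slot hs (fun x => E3 i x pis)); apply: h2.
  - rewrite ip in si lK *; have Kp : K < nth 0 s p.
      by rewrite lt_neqAle eq_sym lK leNgt ltp // ltnn.
    apply/(one_in_slot hs (fun x => E4 x si Kp)); apply: h4 => //.
    by rewrite elambda_nth // lte_fin.
split.
- move=> [//|j] /andP[_ jp]; apply/(one_in_slot hs (fun x => E1 j x jp)).
  have js : (j < size s)%N by lia.
  by apply: h; rewrite ?mem_nth // lt_eqF // ltp // ltnW.
- move=> j pj; apply/(one_in_slot hs (fun x => E3 j x pj)).
  case/andP: pj => pj js; apply: h; rewrite ?mem_nth // gt_eqF //.
  rewrite (@le_lt_trans _ _ (nth 0 s p)) ?mono //; last by lia.
  by rewrite leNgt ltp ?ltnn //; lia.
- case: p ps hp ltp E1 E2 E3 E4 => // p ps hp ltp E1 E2 E3 E4 _.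
  apply/(one_in_slot hs (fun x => E2 p x (erefl _))).
  by apply: h; rewrite ?mem_nth // lt_eqF // ltp.
- move=> sp; rewrite elambda_nth // lte_fin => Kp; rewrite -elambda_nth //.
  apply/(one_in_slot hs (fun x => E4 x sp Kp)).
  by apply: h; rewrite ?mem_nth // gt_eqF.
Qed.

(** * Necessity and sufficiency of the four conditions *)

Theorem theorem3 (R : realType) (N : nat) (hN : (2 <= N)%N)
    (sigma hsigma : N.-tuple R)
    (sigma_lt : sorted <%R sigma) (hsigma_lt : sorted <%R hsigma)
    (K : R) (n : 'I_N)
    (q : nat) (mu : q.-tuple R) (mu_common : is_common sigma hsigma K mu)
    (theta2 : R) (theta2_def : is_theta2 sigma hsigma K mu theta2) :
  (exists (theta : R) (J Jt : 'M[R]_N),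
     [/\ 0 < theta < 1, theta ^+ 2 = theta2,
         is_jacobi J /\ is_jacobi Jt,
         Jt = perturb n theta ((theta ^- 2 - 1) * K) J
       & is_spectrum sigma J /\ is_spectrum hsigma Jt])
  <->
  [/\ interlacing N sigma hsigma K,
      (forall i : 'I_q, Nhat sigma hsigma (tnth mu i) = theta2)
        /\ 0 < theta2 < 1,
      ~~ ((K \in sigma) || (K \in hsigma)) ->
        (q <= minn n (N - n - 1))%N /\ Nhat sigma hsigma K = theta2
    & (K \in sigma) || (K \in hsigma) ->
        (K \in sigma) && (K \in hsigma) /\
        ((q <= minn n (N - n - 1))%N /\ Nhat sigma hsigma K > theta2 \/
         [/\ (q < minn n (N - n - 1))%N, Nhat sigma hsigma K = theta2
           & derive1 (Nhat sigma hsigma) K = 0])].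
Proof.
have us := lt_sorted_uniq sigma_lt; have uh := lt_sorted_uniq hsigma_lt.
have sN := size_tuple sigma; have hsN := size_tuple hsigma.
have sz : size sigma = size hsigma by rewrite sN hsN.
have s0 : (0 < size sigma)%N by rewrite sN; lia.
have slots := @interlacing_slot R sigma hsigma K sigma_lt.
rewrite sN in slots.
have minor (t01 : 0 < theta2 < 1) := @central_minor_iff R sigma hsigma mu K theta2 n
  us uh sz s0 mu_common t01.
rewrite sN size_tuple in minor.
have muE : (forall i : 'I_q, Nhat sigma hsigma (tnth mu i) = theta2) <->
    {in mu, forall m, Nhat sigma hsigma m = theta2}.
  by split=> [h m /tnthP[i ->]|h i]; [|apply: h; apply: mem_tnth].
split.
  move=> [t [J [Jt [/andP[t0 t1] tE [Jj Jtj] JtE [sJ sJt]]]]].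
  have t01 : 0 < theta2 < 1 by rewrite -tE exprn_gt0 //= expr_lt1 // ltW.
  have [|h1 h2 h3 h4] := (minor t01).1.
    rewrite JtE in sJt; rewrite -tE.
    exact: perturbation_central_minor sJt.
  split=> //; last by split=> //; apply/muE.
  by apply/slots => l ls _; apply: slot_unique.
move=> [h1 [/muE h2 t01] h3 h4].
have [|q0 [cm E]] := (minor t01).2.
  (* Interlacing leaves out l = K; there condition IV puts K into [hsigma], and K fills its own
     slot. *)
  split=> // l ls; have [lK|lK] := eqVneq l K.
    have [|/andP[_ Kh] _] := h4; first by rewrite -lK ls.
    by exists K; rewrite // lK slot_self.
  by have [x [[xh sx] _]] := (slots.1 h1) l ls lK; exists x.
have /andP[t0 t1] := t01.
exists (Num.sqrt theta2).
have tE : Num.sqrt theta2 ^+ 2 = theta2 by rewrite sqr_sqrtr // ltW.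
have st0 : 0 < Num.sqrt theta2 by rewrite sqrtr_gt0.
have [J [Jj Jtj sJ sJt]] : exists J : 'M[R]_N,
    let Jt := perturb n (Num.sqrt theta2) ((Num.sqrt theta2 ^- 2 - 1) * K) J in
    [/\ is_jacobi J, is_jacobi Jt, is_spectrum sigma J & is_spectrum hsigma Jt].
  apply: (central_minor_perturbation sigma_lt hsigma_lt sN hsN st0 cm).
  by rewrite tE.
exists J, (perturb n (Num.sqrt theta2) ((Num.sqrt theta2 ^- 2 - 1) * K) J).
split=> //; rewrite st0 /=.
by rewrite -(expr_lt1 (n := 2)) ?tE // ltW.
Qed.
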